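(* A linear free divisor $D\subset\mathbb{C}^n$ with reductive group $G^0_D$ is special, i.e. $\chi_h=\det$ on $G^0_D$.
   Context: A reduced hypersurface $D=\{h=0\}\subset \mathbb{C}^n$ is a linear free divisor if $\mathrm{Der}(-\log D)=\{\chi:\chi\cdot h\in(h)\}$ is a free module with a basis of weight-zero vector fields (all coefficients linear forms); then the reduced equation $h$ is homogeneous of degree $n$. $G^0_D\subset \mathrm{GL}_n(\mathbb{C})$ is the identity component of $\{A\in \mathrm{GL}_n(\mathbb{C}):AD=D\}$. For $g\in G_D^0$ one has $h\circ g=\chi_h(g)h$ for a character $\chi_h:G_D^0\to\mathbb{C}^*$. $D$ is called special if $\chi_h$ equals the determinant of the representation of $G^0_D$ on $\mathbb{C}^n$. *)

(* Defs.v *)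
From HB Require Import structures.
From mathcomp Require Import all_boot all_order all_algebra.
From mathcomp Require Import complex.
From mathcomp Require Import boolp classical_sets reals topology normedtype.
(* The notations of mpoly clash with those of the analysis library. *)
From mathcomp Require mpoly.
Import -(notations) mpoly.

Set Implicit Arguments.
Unset Strict Implicit.
Unset Printing Implicit Defensive.

Import GRing.Theory Num.Theory numFieldNormedType.Exports.
Local Open Scope classical_set_scope.
Local Open Scope ring_scope.

(* The complex numbers. The numClosedFieldType packaging is what gives
   'M[Cplx R]_n its topology: the product topology for the usual absolute
   value of R[i]. *)
Definition Cplx (R : realType) : numClosedFieldType := R[i].

Notation "{ 'mpoly' T [ n ] }" := (mpoly n T) : type_scope.

Section LinearFreeDivisors.
Variables (R : realType) (n : nat).
Local Notation C := (Cplx R).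
Local Notation poly := {mpoly C[n]}.
(* The row (a_0, ..., a_{n-1}) stands for the vector field
   a_0 d/dx_0 + ... + a_{n-1} d/dx_{n-1}. *)
Local Notation vfield := 'rV[poly]_n.

Implicit Types (h f : poly) (X : vfield) (N G : set 'M[C]_n).

Definition in_ideal h f : Prop := exists q : poly, f = q * h.

Definition evalcv f (x : 'cV[C]_n) : C := meval (fun i => x i 0) f.

Definition zero_locus h : set 'cV[C]_n := [set x | evalcv h x = 0].

(* h is non-constant (mmeasure mdeg is 1 + the total degree) and C[x]/(h) has
   no nonzero nilpotent elements. *)
Definition reduced_hypersurface h : Prop :=
  (1 < mmeasure mdeg h)%N /\
  forall f (k : nat), in_ideal h (f ^+ k) -> in_ideal h f.

Definition vf_apply X f : poly := \sum_(i < n) X 0 i * mderiv i f.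

Definition Der_log h : set vfield := [set X | in_ideal h (vf_apply X h)].

Definition weight_zero X : Prop := forall i, X 0 i \is ishomog1 1%N mdeg.

Definition free_basis (M : set vfield) (m : nat) (b : 'I_m -> vfield) : Prop :=
  [/\ forall j, M (b j),
      forall X, M X -> exists c : 'I_m -> poly, X = \sum_j c j *: b j &
      forall c : 'I_m -> poly, \sum_j c j *: b j = 0 -> forall j, c j = 0].

Definition linear_free_divisor h : Prop :=
  reduced_hypersurface h /\
  exists (m : nat) (b : 'I_m -> vfield),
    free_basis (Der_log h) b /\ forall j, weight_zero (b j).

Definition stabilizer h : set 'M[C]_n :=
  [set A | A \in unitmx /\
           (fun x => A *m x) @` zero_locus h = zero_locus h].

(* The identity component in the Euclidean topology; for a linear algebraic
   group over C it is also the one in the Zariski topology. *)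
Definition G0 h : set 'M[C]_n := connected_component (stabilizer h) 1%:M.

Definition subgroup_GL N : Prop :=
  [/\ N `<=` [set A | A \in unitmx], N 1%:M,
      forall A B, N A -> N B -> N (A *m B) &
      forall A, N A -> N (invmx A)].

(* The matrix entries are the n * n coordinates. *)
Definition zariski_closed_GL N : Prop :=
  exists S : set {mpoly C[n * n]},
    N = [set A | A \in unitmx /\
                 forall p, S p -> meval (fun k => mxvec A 0 k) p = 0].

Definition normal_in N G : Prop :=
  N `<=` G /\ forall g u, G g -> N u -> N (g *m u *m invmx g).

Definition unipotent (u : 'M[C]_n) : Prop :=
  exists k : nat, (u - 1%:M) ^+ k = 0.

(* The unipotent radical, i.e. the largest closed connected normal unipotent
   subgroup, is trivial. *)
Definition reductive G : Prop :=
  forall N, subgroup_GL N -> zariski_closed_GL N -> connected N ->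
    normal_in N G -> (forall u, N u -> unipotent u) -> N = [set 1%:M].

(* chi is the character of G0 h with h \o g = chi g * h; its values outside
   G0 h are irrelevant, and on G0 h they are determined by h since h != 0. *)
Definition associated_character h (chi : 'M[C]_n -> C) : Prop :=
  [/\ forall g, G0 h g -> chi g != 0,
      forall g1 g2, G0 h g1 -> G0 h g2 -> chi (g1 *m g2) = chi g1 * chi g2 &
      forall g, G0 h g -> forall x, evalcv h (g *m x) = chi g * evalcv h x].

Definition special h : Prop :=
  exists2 chi : 'M[C]_n -> C, associated_character h chi &
    forall g, G0 h g -> chi g = \det g.

End LinearFreeDivisors.

(* Main.v *)
From HB Require Import structures.
From mathcomp Require Import all_boot all_order all_algebra all_field.
From mathcomp Require Import ssrAC complex.
From mathcomp Require Import boolp classical_sets reals topology normedtype.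
From mathcomp Require mpoly.
Import -(notations) mpoly.
From mathcomp Require Import ring.
Require Import Defs.

(* Let g be the Lie algebra of matrices A such that the vector field A x
   preserves the ideal (h), with basis A_1, ..., A_m.  Saito's criterion gives
   m = n and det (A_1 x, ..., A_n x) = c h with c != 0, so replacing x by g x,
   for g in G0, yields chi_h(g) = det(g) / det(Ad g).
   The trace form tr(X Y) on g is Ad-invariant.  Its radical consists of
   nilpotent matrices (Cartan's criterion, since g contains with X the matrix
   obtained by conjugating the eigenvalues of the semisimple part of X), so by
   Engel's theorem it has a nonzero centre unless it is zero; the exponential of
   this centre is a closed connected normal unipotent subgroup of G0, hence
   trivial when G0 is reductive.  So the trace form is nondegenerate and
   det(Ad g) is 1 or -1; it is 1 because G0 is connected.
   That h o g is a multiple of h for g in G0 also follows from connectedness: on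
   every line, h o g has the same zeros as h and bounded degree. *)

Set Implicit Arguments.
Unset Strict Implicit.
Unset Printing Implicit Defensive.

Import Order.TTheory GRing.Theory Num.Theory.
Local Open Scope ring_scope.

(** Saito's criterion is reached without factoring h and without smooth points of the hypersurface.
    On the line x + s q through the generic point x, in a direction q where the leading form of h is
    nonzero, h becomes a polynomial in s with constant leading coefficient; reducedness makes it
    coprime to its derivative, and this replaces generic smoothness. The form is that of the given
    representation, not the Killing form, so that its radical is nilpotent as a set of matrices and
    exponentiates to unipotent ones. The conjugate replica stays in g because X multiplies h by c
    exactly when the monomials of h, in coordinates adapted to X, have weight sum m_i lam_i = c for
    its semisimple part; the m_i being integers, this survives conjugation. Only the centre of the
    radical is exponentiated: on commuting matrices exp is a homomorphism, and on nilpotent ones it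
    is polynomial with polynomial inverse, whence Zariski closedness. The sign of det(Ad g) is
    decided through the continuous functions h(g p) and det g, at a point p with h(p) nonzero, so Ad
    need not be followed continuously in g. *)

Local Notation var i := (mpolyX _ (mnm1 i)).

(** * Linear substitutions and linear vector fields *)

Section Substitution.
Variables (F : numClosedFieldType) (n : nat).
Local Notation poly := {mpoly F[n]}.
Implicit Types (f g : poly) (A B : 'M[F]_n).

Lemma mpoly_ring_ind (P : poly -> Prop) :
  (forall c, P (mpolyC n c)) -> (forall i, P (var i)) ->
  (forall f g, P f -> P g -> P (f + g)) ->
  (forall f g, P f -> P g -> P (f * g)) -> forall f, P f.
Proof.
move=> PC PX PD PM.
have P1 : P 1 by rewrite -mpolyC1; apply: PC.
apply: (@mpolyind n F P) => [|c m g _ _ IH]; first by rewrite -mpolyC0; apply: PC.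
apply: PD => //; rewrite -mul_mpolyC; apply: (PM) => //.
rewrite mpolyXE_id; apply: (big_ind P) => // i _.
by elim: (m i) => [|k IHk]; rewrite ?expr0 // exprS; apply: PM.
Qed.

Lemma mderivU (i j : 'I_n) : mderiv j (var i : poly) = (i == j)%:R.
Proof.
rewrite mderivX mnm1E; have [->|] := eqVneq; last by rewrite scale0r.
rewrite scale1r; suff -> : mnm_sub (mnm1 j) (mnm1 j) = mnm0 by rewrite mpolyX0.
by apply/mnmP => k; rewrite mnmBE subnn mnm0E.
Qed.

(** A derivation along [phi] is determined by its values on the variables. This serves linear
    substitutions, restrictions to lines and the curve exp(tZ) x. *)
Lemma chain_rule (S : comNzRingType) (phi : {rmorphism poly -> S})
    (d : poly -> S) :
  (forall f g, d (f + g) = d f + d g) -> (forall c, d (mpolyC n c) = 0) ->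
  (forall f g, d (f * g) = d f * phi g + phi f * d g) ->
  forall f, d f = \sum_i phi (mderiv i f) * d (var i).
Proof.
move=> dD dC dM; apply: mpoly_ring_ind => [c|i|f g IHf IHg|f g IHf IHg].
- by rewrite dC big1 // => i _; rewrite mderivC raddf0 mul0r.
- rewrite (bigD1 i) //= mderivU eqxx rmorph1 mul1r big1 ?addr0 // => j ji.
  by rewrite mderivU eq_sym (negbTE ji) raddf0 mul0r.
- rewrite dD IHf IHg -big_split; apply: eq_bigr => i _ /=.
  by rewrite mderivD rmorphD mulrDl.
- rewrite dM IHf IHg mulr_suml mulr_sumr -big_split; apply: eq_bigr => i _ /=.
  by rewrite mderivM rmorphD !rmorphM /=; ring.
Qed.

Lemma eq_rmorph_mpoly (S : comNzRingType) (phi psi : {rmorphism poly -> S}) :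
  (forall c, phi (mpolyC n c) = psi (mpolyC n c)) ->
  (forall i, phi (var i) = psi (var i)) -> phi =1 psi.
Proof.
move=> eqC eqX; apply: mpoly_ring_ind => [||f g|f g] //.
  by rewrite !rmorphD => -> ->.
by rewrite !rmorphM => -> ->.
Qed.

Definition lin_form A (i : 'I_n) : poly := \sum_k A i k *: var k.

Definition lsubst A : poly -> poly := comp_mpoly [tuple lin_form A i | i < n].
HB.instance Definition _ A := GRing.RMorphism.on (lsubst A).
HB.instance Definition _ A := GRing.Linear.on (lsubst A).

Lemma lsubstC A c : lsubst A (mpolyC n c) = mpolyC n c.
Proof. exact: comp_mpolyC. Qed.

Lemma lsubstX A i : lsubst A (var i) = lin_form A i.
Proof. by rewrite /lsubst comp_mpolyXU -tnth_nth tnth_mktuple. Qed.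

Lemma lsubst_lin_form A B i : lsubst B (lin_form A i) = lin_form (A *m B) i.
Proof.
rewrite /lin_form raddf_sum /=.
under eq_bigr => k _ do rewrite linearZ /= lsubstX scaler_sumr.
rewrite exchange_big /=; apply: eq_bigr => j _.
by under eq_bigr => k _ do rewrite scalerA; rewrite -scaler_suml mxE.
Qed.

Lemma lsubstM A B f : lsubst B (lsubst A f) = lsubst (A *m B) f.
Proof.
rewrite -[LHS]/((lsubst B \o lsubst A) f).
move: f; apply: eq_rmorph_mpoly => [c|i] /=; first by rewrite !lsubstC.
by rewrite !lsubstX lsubst_lin_form.
Qed.

Lemma lin_form1 i : lin_form 1%:M i = var i.
Proof.
rewrite /lin_form (bigD1 i) //= mxE eqxx scale1r big1 ?addr0 // => j ji.
by rewrite mxE eq_sym (negbTE ji) scale0r.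
Qed.

Lemma lsubst1 f : lsubst 1%:M f = f.
Proof.
rewrite -[RHS]/(idfun f); move: f.
apply: eq_rmorph_mpoly => [c|i] /=; first by rewrite !lsubstC.
by rewrite !lsubstX lin_form1.
Qed.

Lemma lin_formD A B i : lin_form (A + B) i = lin_form A i + lin_form B i.
Proof.
by rewrite /lin_form -big_split; apply: eq_bigr => k _; rewrite mxE scalerDl.
Qed.

Lemma lin_formZ c A i : lin_form (c *: A) i = c *: lin_form A i.
Proof.
by rewrite /lin_form scaler_sumr; apply: eq_bigr => k _; rewrite mxE scalerA.
Qed.

(* The derivation of polynomials given by the linear vector field x |-> A x. *)
Definition lder A f : poly := \sum_i lin_form A i * mderiv i f.

Lemma lder_is_linear A : linear (lder A).
Proof.
move=> c f g; rewrite /lder scaler_sumr -big_split; apply: eq_bigr => i _ /=.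
by rewrite mderivD mderivZ mulrDr scalerAr.
Qed.
HB.instance Definition _ A :=
  GRing.isLinear.Build F poly poly _ (lder A) (lder_is_linear A).

Lemma lderM A f g : lder A (f * g) = lder A f * g + f * lder A g.
Proof.
rewrite /lder mulr_suml mulr_sumr -big_split; apply: eq_bigr => i _ /=.
by rewrite mderivM; ring.
Qed.

Lemma lderC A c : lder A (mpolyC n c) = 0.
Proof. by rewrite /lder big1 // => i _; rewrite mderivC mulr0. Qed.

Lemma lderX A i : lder A (var i) = lin_form A i.
Proof.
rewrite /lder (bigD1 i) //= mderivU eqxx mulr1 big1 ?addr0 // => j ji.
by rewrite mderivU eq_sym (negbTE ji) mulr0.
Qed.

Lemma lder_lin_form A B i : lder A (lin_form B i) = lin_form (B *m A) i.
Proof.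
rewrite /lin_form raddf_sum /=.
under eq_bigr => k _ do rewrite linearZ /= lderX scaler_sumr.
rewrite exchange_big /=; apply: eq_bigr => j _.
by under eq_bigr => k _ do rewrite scalerA; rewrite -scaler_suml mxE.
Qed.

Lemma lderD A B f : lder (A + B) f = lder A f + lder B f.
Proof.
by rewrite /lder -big_split; apply: eq_bigr => i _; rewrite lin_formD mulrDl.
Qed.

Lemma lderZ c A f : lder (c *: A) f = c *: lder A f.
Proof.
by rewrite /lder scaler_sumr; apply: eq_bigr => i _; rewrite lin_formZ scalerAl.
Qed.

Lemma lder0 f : lder 0 f = 0.
Proof. by rewrite -(scale0r 0) lderZ scale0r. Qed.

(** [lder A] turns the coordinates of B x into those of B A x, so passing from matrices to
    derivations reverses brackets. *)
Lemma lder_comm A B f :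
  lder A (lder B f) - lder B (lder A f) = lder (B *m A - A *m B) f.
Proof.
move: f; apply: mpoly_ring_ind => [c|i|f g IHf IHg|f g IHf IHg].
- by rewrite !lderC !raddf0 addr0.
- by rewrite !lderX !lder_lin_form lin_formD -[- (A *m B)]scaleN1r lin_formZ scaleN1r.
- by rewrite !raddfD /= -IHf -IHg; ring.
- by rewrite !lderM !raddfD /= !lderM -IHf -IHg; ring.
Qed.

Lemma lder_lsubst A B f :
  lder A (lsubst B f) = \sum_i lsubst B (mderiv i f) * lin_form (B *m A) i.
Proof.
rewrite (@chain_rule _ (lsubst B) (fun f => lder A (lsubst B f))).
- by apply: eq_bigr => i _; rewrite lsubstX lder_lin_form.
- by move=> g h; rewrite !raddfD.
- by move=> c; rewrite lsubstC lderC.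
- by move=> g h; rewrite rmorphM lderM.
Qed.

Lemma lder_lsubst_conj A B f : B \in unitmx ->
  lder A (lsubst B f) = lsubst B (lder (B *m A *m invmx B) f).
Proof.
move=> uB; rewrite lder_lsubst raddf_sum; apply: eq_bigr => i _ /=.
by rewrite rmorphM /= lsubst_lin_form mulmxKV // mulrC.
Qed.

End Substitution.

(** * Semisimple and nilpotent parts *)

Section CRT.
Variables (F : fieldType) (k : nat).
Implicit Types (s : seq F) (f g : {poly F}).
Local Notation XB a := (('X - a%:P) ^+ k).

Lemma coprimep_XsubCX_prod a s : a \notin s ->
  coprimep (XB a) (\prod_(b <- s) XB b).
Proof.
elim: s => [|b s IH]; first by rewrite big_nil coprimep1.
rewrite inE negb_or big_cons coprimepMr => /andP[ab /IH->]; rewrite andbT.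
by rewrite coprimep_expl // coprimep_expr // coprimep_XsubC2 // subr_eq0 eq_sym.
Qed.

Lemma dvdp_prod_XsubCX s f : uniq s -> (forall a, a \in s -> XB a %| f) ->
  \prod_(b <- s) XB b %| f.
Proof.
elim: s => [|b s IH] /=; first by rewrite big_nil dvd1p.
move=> /andP[bs us] sf; rewrite big_cons Gauss_dvdp ?coprimep_XsubCX_prod //.
rewrite sf ?mem_head // IH // => a as_; apply: sf.
by rewrite inE as_ orbT.
Qed.

(** Evaluated at a matrix whose distinct eigenvalues are listed in s, with k at least their
    multiplicities, f gives the semisimple part. *)
Lemma polynomial_crt s : uniq s ->
  exists f, forall a, a \in s -> XB a %| f - a%:P.
Proof.
elim: s => [|b s IH] /=; first by exists 0.
move=> /andP[bs /IH[f fP]].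
have /Bezout_eq1_coprimepP[[u v] /= uv] := coprimep_XsubCX_prod bs.
set p := XB b in uv; set q := \prod_(_ <- _) _ in uv.
exists (f * (u * p) + b%:P * (v * q)) => a; rewrite inE.
have vq : v * q = 1 - u * p by rewrite -uv addrC addKr.
have up : u * p = 1 - v * q by rewrite -uv addrK.
case: eqVneq => [->|ab] /= as_.
  suff -> : f * (u * p) + b%:P * (v * q) - b%:P = p * (u * (f - b%:P)).
    by rewrite dvdp_mulr.
  by rewrite vq; ring.
have -> : f * (u * p) + b%:P * (v * q) - a%:P =
          (f - a%:P) + q * (v * (b%:P - f)) by rewrite up; ring.
by rewrite dvdp_addr ?fP // dvdp_mulr // /q (big_rem a) //= dvdp_mulr.
Qed.

End CRT.

Section Nilpotent.
Variables (F : closedFieldType).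

Lemma nilpotent_char_poly n (N : 'M[F]_n) k : N ^+ k = 0 -> char_poly N = 'X^n.
Proof.
case: n N => [|n] N Nk.
  by rewrite /char_poly det_mx00 expr0.
have [r rE] := closed_field_poly_normal (char_poly N).
rewrite (monicP (char_poly_monic _)) scale1r in rE.
have r0 : all (pred1 0) r.
  apply/allP => z zr /=.
  have : root (char_poly N) z by rewrite rE root_prod_XsubC.
  rewrite -eigenvalue_root_char => /eigenvalueP[v vN v0].
  have vk j : v *m N ^+ j = z ^+ j *: v.
    elim: j => [|j IHj]; first by rewrite !expr0 mulmx1 scale1r.
    by rewrite exprSr -mulmxE mulmxA IHj -scalemxAl vN scalerA exprSr.
  move: (vk k); rewrite Nk mulmx0 => /esym/eqP.
  by rewrite scaler_eq0 (negbTE v0) orbF expf_eq0 => /andP[].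
have sr : size r = n.+1.
  by have := size_char_poly N; rewrite rE size_prod_XsubC => -[].
rewrite rE (all_pred1P _ _ r0) sr.
by rewrite big_nseq subr0 -Monoid.iteropE.
Qed.

Lemma nilpotent_exprn n (N : 'M[F]_n) k : N ^+ k = 0 -> N ^+ n = 0.
Proof.
case: n N => [|n] N /nilpotent_char_poly chN; first exact: flatmx0.
by have := Cayley_Hamilton N; rewrite chN rmorphXn /= horner_mx_X.
Qed.

Lemma nilpotent_trace n (N : 'M[F]_n) k : N ^+ k = 0 -> \tr N = 0.
Proof.
case: n N => [|n] N /nilpotent_char_poly chN; first by rewrite /mxtrace big_ord0.
have := char_poly_trace N (ltn0Sn n); rewrite chN coefXn /=.
by rewrite ltn_eqF // => /eqP; rewrite eq_sym oppr_eq0 => /eqP.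
Qed.

(** With f from the Chinese remainder theorem, S = f(X) is killed by the product of the T - a over
    the distinct eigenvalues a, hence is diagonalizable; T - f is divisible by every T - a, so X - S
    is nilpotent. Both commute, being polynomials in X. *)
Lemma jordan_chevalley n (X : 'M[F]_n) : exists P (lam : 'rV[F]_n) (N : 'M[F]_n),
  [/\ P \in unitmx, P *m X *m invmx P = diag_mx lam + N,
      comm_mx N (diag_mx lam) & N ^+ n = 0].
Proof.
case: n X => [|n] X.
  by exists 1%:M, 0, 0; split; rewrite ?unitmx1 //; apply/matrixP => -[].
have [r rE] := closed_field_poly_normal (char_poly X).
rewrite (monicP (char_poly_monic _)) scale1r in rE.
have sr : size r = n.+1.
  by have := size_char_poly X; rewrite rE size_prod_XsubC => -[].
pose s := undup r; have us : uniq s by apply: undup_uniq.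
(* The exponent is the matrix size, which bounds every multiplicity in the characteristic
   polynomial. *)
have chdvd g : (forall a, a \in s -> ('X - a%:P) ^+ n.+1 %| g) ->
    horner_mx X g = 0.
  move=> /(dvdp_prod_XsubCX us) dg; apply/mxminpoly_minP.
  apply: (dvdp_trans (mxminpoly_dvd_char X)); apply: dvdp_trans dg.
  rewrite rE -prodr_undup_exp_count -/s.
  elim/big_ind2: _ => // [a b c d ab cd|a _]; first exact: dvdp_mul.
  by rewrite dvdp_exp2l // -sr count_size.
have [f fP] := polynomial_crt n.+1 us.
pose S := horner_mx X f; pose N := X - S.
have N0 : N ^+ n.+1 = 0.
  have -> : N = horner_mx X ('X - f) by rewrite rmorphB /= horner_mx_X.
  rewrite -rmorphXn; apply: chdvd => a /fP fa; apply: dvdp_exp2r.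
  rewrite -(opprB f) dvdpNr.
  have -> : f - 'X = (f - a%:P) - ('X - a%:P) by rewrite opprB addrA subrK.
  rewrite dvdp_sub //.
  by apply: dvdp_trans fa; rewrite exprS dvdp_mulr.
have : diagonalizable S.
  apply/diagonalizableP; exists s => //; apply/mxminpoly_minP.
  have -> : horner_mx S (\prod_(x <- s) ('X - x%:P)) =
            horner_mx X (\prod_(x <- s) (f - x%:P)).
    rewrite !rmorph_prod; apply: eq_bigr => z _.
    by rewrite !rmorphB /= horner_mx_X !horner_mx_C.
  by apply: chdvd => a as_; rewrite (big_rem a) //= dvdp_mulr // fP.
move=> [P uP /(diagonalizable_forPex) [d /(simmxRL uP) dE]].
have dE' := esym dE.
have cNS : N *m S = S *m N.
  rewrite mulmxBl mulmxBr; congr (_ - _).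
  exact/comm_mx_horner/comm_mx_refl.
have conjM A B : P *m (A *m B) *m invmx P =
    (P *m A *m invmx P) *m (P *m B *m invmx P).
  by rewrite !mulmxA mulmxKV.
have conjX A k : (P *m A *m invmx P) ^+ k = P *m A ^+ k *m invmx P.
  elim: k => [|k IH]; first by rewrite !expr0 mulmx1 mulmxV.
  by rewrite !exprS IH -!mulmxE conjM.
exists P, d, (P *m N *m invmx P); split => //.
- by rewrite -dE' -mulmxDl -mulmxDr addrC subrK.
- by rewrite /comm_mx -dE' -!conjM cNS.
- by rewrite conjX N0 mulmx0 mul0mx.
Qed.

End Nilpotent.

(** * Polynomials that are eigenvectors of a linear vector field *)

Section EigenDerivation.
Variables (F : numClosedFieldType) (n : nat).
Local Notation poly := {mpoly F[n]}.
Implicit Types (f g : poly) (A B N X : 'M[F]_n).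

(** Commuting with diag(lam) means that N i j = 0 unless lam_i = lam_j, and then mu_i = mu_j as
    well. *)
Lemma comm_diag_mx (lam mu : 'rV[F]_n) N :
  (forall i j, lam 0 i = lam 0 j -> mu 0 i = mu 0 j) ->
  comm_mx N (diag_mx lam) -> comm_mx N (diag_mx mu).
Proof.
move=> lm /matrixP cN; apply/matrixP => i j; move: (cN i j).
rewrite !mul_mx_diag !mul_diag_mx !mxE.
have [-> //|Nij] := eqVneq (N i j) 0; first by rewrite !mul0r !mulr0.
by rewrite mulrC => /(mulIf Nij) /lm ->; rewrite mulrC.
Qed.

Lemma lder_diag_monom (lam : 'rV[F]_n) (m : multinom n) :
  lder (diag_mx lam) (mpolyX _ m) = (\sum_i lam 0 i *+ m i) *: mpolyX _ m.
Proof.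
rewrite /lder scaler_suml; apply: eq_bigr => i _.
have -> : lin_form (diag_mx lam) i = lam 0 i *: var i.
  rewrite /lin_form (bigD1 i) //= mxE eqxx big1 ?addr0 // => j ji.
  by rewrite mxE eq_sym (negbTE ji) scale0r.
rewrite mderivX -scalerAl -scalerAr scalerA mulr_natr.
have [mi|mi] := eqVneq (m i) 0%N; first by rewrite mi !scale0r.
by rewrite -mpolyXD addmC submK // lep1mP.
Qed.

Lemma mcoeff_lder_diag (lam : 'rV[F]_n) f (m : multinom n) :
  mcoeff m (lder (diag_mx lam) f) = (\sum_i lam 0 i *+ m i) * mcoeff m f.
Proof.
elim/mpolyind: f => [|c m' f _ _ IH]; first by rewrite raddf0 !mcoeff0 mulr0.
rewrite raddfD /= linearZ /= lder_diag_monom !mcoeffD IH mulrDr; congr (_ + _).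
rewrite scalerA !mcoeffZ mcoeffX; case: eqVneq => [->|_].
  by rewrite !mulr1 mulrC.
by rewrite !mulr0.
Qed.

(** [lder N] kills each variable after k steps, and by the Leibniz rule the elements killed by some
    power of a derivation form a subring. The power depends on f. *)
Lemma lder_locally_nilpotent N k f :
  N ^+ k = 0 -> exists j, iter j (lder N) f = 0.
Proof.
move=> Nk.
have itD j : {morph iter j (lder N) : f g / f + g}.
  by elim: j => [//|j IH] g g' /=; rewrite IH raddfD.
have iter0 i j g : iter i (lder N) g = 0 -> (i <= j)%N -> iter j (lder N) g = 0.
  move=> gi /subnK<-; rewrite iterD gi.
  by elim: (j - i)%N => //= l ->; rewrite raddf0.
have iterM a b g g' : iter a (lder N) g = 0 -> iter b (lder N) g' = 0 ->
    iter (a + b) (lder N) (g * g') = 0.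
  move: {2}(a + b)%N (leqnn (a + b)) => c.
  elim: c => [|c IH] in a b g g' *.
    by rewrite leqn0 addn_eq0 => /andP[/eqP-> /eqP->] /= -> _; rewrite mul0r.
  case: a => [|a]; first by move=> _ /= -> _; rewrite mul0r (iter0 0%N).
  case: b => [|b]; first by move=> _ _ g0; rewrite (g0 : g' = 0) mulr0 (iter0 0%N).
  move=> le ga gb; rewrite addSn iterSr lderM itD.
  rewrite IH ?add0r //; last by rewrite -iterSr.
  by rewrite addnS -addSn IH // -?iterSr //; rewrite addSnnS.
move: f; apply: mpoly_ring_ind.
- by move=> c; exists 1%N; rewrite /= lderC.
- move=> i; exists k.
  have -> j : iter j (lder N) (var i) = lin_form (N ^+ j) i.
    elim: j => [|j IH]; first by rewrite /= expr0 lin_form1.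
    by rewrite iterS IH lder_lin_form exprSr.
  by rewrite Nk /lin_form big1 // => j _; rewrite mxE scale0r.
- move=> g g' [a ga] [b gb]; exists (a + b)%N; rewrite itD.
  by rewrite (iter0 a) ?leq_addr // (iter0 b) ?leq_addl // addr0.
- by move=> g g' [a ga] [b gb]; exists (a + b)%N; apply: iterM.
Qed.

Lemma nilpotent_eigen N k f c : N ^+ k = 0 -> f != 0 -> lder N f = c *: f ->
  c = 0.
Proof.
move=> Nk f0 Nf; have [j fj] := lder_locally_nilpotent f Nk.
have : c ^+ j *: f = 0.
  rewrite -fj; elim: j {fj} => [|j IH]; first by rewrite scale1r.
  by rewrite iterS -IH linearZ /= Nf scalerA exprSr.
by move=> /eqP; rewrite scaler_eq0 (negbTE f0) orbF expf_eq0 => /andP[_ /eqP].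
Qed.

(* The semisimple and nilpotent parts commute and the latter acts locally
   nilpotently on polynomials, so only monomials of weight c occur in f. *)
Lemma lder_diag_eigen (lam : 'rV[F]_n) N k f c :
  comm_mx N (diag_mx lam) -> N ^+ k = 0 ->
  lder (diag_mx lam + N) f = c *: f ->
  forall m : multinom n, (\sum_i lam 0 i *+ m i - c) * mcoeff m f = 0.
Proof.
move=> cN Nk fE m; have [j fj] := lder_locally_nilpotent f Nk.
pose D g := lder (diag_mx lam) g - c *: g.
have DN g : D (lder N g) = lder N (D g).
  rewrite /D raddfB /= [lder N (c *: g)]linearZ /=; congr (_ - _).
  by apply/eqP; rewrite -subr_eq0 lder_comm cN subrr lder0.
have iDN i g : iter i D (lder N g) = lder N (iter i D g).
  by elim: i => //= i ->; rewrite DN.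
have Df : D f = - lder N f.
  by rewrite /D -fE lderD opprD addrA subrr add0r.
have iD i : iter i D f = (-1) ^+ i *: iter i (lder N) f.
  elim: i => [|i IH]; first by rewrite scale1r.
  rewrite iterSr Df.
  have -> : - lder N f = lder N (- f) by rewrite raddfN.
  rewrite iDN.
  have -> : iter i D (- f) = - iter i D f.
    elim: {IH} i => //= i ->; rewrite /D raddfN /= scalerN; ring.
  by rewrite IH raddfN /= linearZ /= exprS mulN1r scaleNr.
have mD g : mcoeff m (D g) = (\sum_i lam 0 i *+ m i - c) * mcoeff m g.
  by rewrite /D mcoeffB mcoeffZ mcoeff_lder_diag mulrBl.
have miD i : mcoeff m (iter i D f) =
    (\sum_i lam 0 i *+ m i - c) ^+ i * mcoeff m f.
  by elim: i => [|i IH] /=; rewrite ?expr0 ?mul1r // mD IH mulrA exprS.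
have := miD j; rewrite iD fj scaler0 mcoeff0 => /esym/eqP.
rewrite mulf_eq0 expf_eq0 => /orP[/andP[_ /eqP->]|/eqP->].
  by rewrite mul0r.
by rewrite mulr0.
Qed.

Lemma lsubst_inj B : B \in unitmx -> injective (@lsubst F n B).
Proof.
by move=> uB f g /(congr1 (lsubst (invmx B))); rewrite !lsubstM mulmxV ?lsubst1.
Qed.

(* The eigenvalues of the semisimple part are replaced by their conjugates. *)
Lemma conjugate_replica X f c : lder X f = c *: f ->
  exists Y (lam : 'rV[F]_n), [/\ lder Y f = c^* *: f,
    \tr (X *m Y) = \sum_i `|lam 0 i| ^+ 2 & lam = 0 -> X ^+ n = 0].
Proof.
move=> Xf; have [P [lam [N [uP XE cN N0]]]] := jordan_chevalley X.
pose mu : 'rV[F]_n := \row_i (lam 0 i)^*.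
have uPi : invmx P \in unitmx by rewrite unitmx_inv.
pose f' := lsubst (invmx P) f.
have f'E : lder (diag_mx lam + N) f' = c *: f'.
  rewrite lder_lsubst_conj // invmxK -XE !mulmxA mulVmx // mul1mx mulmxKV //.
  by rewrite Xf linearZ.
have f'D : lder (diag_mx mu) f' = c^* *: f'.
  apply/mpolyP => m; rewrite mcoeff_lder_diag mcoeffZ.
  have /eqP := lder_diag_eigen cN N0 f'E m.
  rewrite mulf_eq0 => /orP[|/eqP->]; last by rewrite !mulr0.
  rewrite subr_eq0 => /eqP <-; rewrite rmorph_sum; congr (_ * _).
  by apply: eq_bigr => i _; rewrite rmorphMn mxE.
exists (invmx P *m diag_mx mu *m P), lam; split.
- apply: (lsubst_inj uPi); move: f'D; rewrite lder_lsubst_conj // invmxK => ->.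
  by rewrite linearZ.
- rewrite !mulmxA mxtrace_mulC !mulmxA XE mulmxDl raddfD /=.
  have cM : comm_mx N (diag_mx mu).
    by apply: comm_diag_mx cN => i j; rewrite !mxE => ->.
  rewrite (@nilpotent_trace _ _ (N *m diag_mx mu) n) ?addr0; last first.
    by rewrite mulmxE exprMn_comm // N0 mul0r.
  rewrite mulmx_diag mxtrace_diag; apply: eq_bigr => i _.
  by rewrite !mxE -normCK.
- move=> lam0; move: XE; rewrite lam0 raddf0 add0r => XE.
  have -> : X = invmx P *m N *m P.
    by rewrite -XE !mulmxA mulVmx // mul1mx mulmxKV.
  suff -> k : (invmx P *m N *m P) ^+ k = invmx P *m N ^+ k *m P.
    by rewrite N0 mulmx0 mul0mx.
  elim: k => [|k IH]; first by rewrite !expr0 mulmx1 mulVmx.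
  by rewrite !exprS IH -!mulmxE !mulmxA mulmxK.
Qed.

End EigenDerivation.

(** * Engel's theorem *)

Section Words.
Variables (T : pzRingType).
Implicit Types (P Q : T -> Prop) (s u v : seq T) (x y z : T).

Definition word P s := forall x, x \in s -> P x.

Definition words_vanish P K := forall s, word P s -> size s = K -> \prod_(x <- s) x = 0.

Lemma word_cat P u v : word P u -> word P v -> word P (u ++ v).
Proof. by move=> Pu Pv x; rewrite mem_cat => /orP[/Pu|/Pv]. Qed.

Lemma word_cons P x u : P x -> word P u -> word P (x :: u).
Proof. by move=> Px Pu y; rewrite inE => /predU1P[->|/Pu]. Qed.

Lemma word_consE P x u : word P (x :: u) -> P x /\ word P u.
Proof.
by move=> Pxu; split=> [|y yu]; apply: Pxu; rewrite inE ?eqxx ?yu ?orbT.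
Qed.

Lemma words_vanish_ge P K s : words_vanish P K -> word P s -> (K <= size s)%N ->
  \prod_(x <- s) x = 0.
Proof.
move=> PK Ps le; rewrite -(cat_take_drop K s) big_cat /= PK ?mul0r //.
  by move=> x /mem_take /Ps.
by rewrite size_takel.
Qed.

(** Repeated brackets of y with elements of P expand into words in which y is flanked by letters of
    P; after 2K brackets one flank has K letters and every word vanishes. The lemma is applied with
    a Q that excludes 0: a chain then has to stop at some y whose brackets with P all leave Q. *)
Lemma ad_chain P Q K x : words_vanish P K ->
  (forall y, Q y -> exists2 w, P w & Q (w * y - y * w)) -> Q x -> Q 0.
Proof.
move=> PK step Qx.
pose Z m y := forall u v, word P u -> word P v -> (m <= size u + size v)%N ->
  \prod_(w <- u) w * y * \prod_(w <- v) w = 0.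
suff ZQ m y : Z m y -> Q y -> Q 0.
  apply: (ZQ (K + K)%N x) Qx => u v Pu Pv le.
  have [Ku|uK] := leqP K (size u).
    by rewrite (words_vanish_ge PK Pu Ku) !mul0r.
  rewrite (words_vanish_ge PK Pv) ?mulr0 // leqNgt; apply/negP => vK.
  by move: le; rewrite leqNgt -addnS leq_add // ltnW.
elim: m y => [|m IH] y Zy Qy.
  by have := Zy [::] [::]; rewrite !big_nil mul1r mulr1 => <-.
have [w Pw Qw] := step y Qy; apply: IH Qw => u v Pu Pv le.
have := Zy (rcons u w) v; rewrite size_rcons big_rcons /= => Zl.
have := Zy u (w :: v); rewrite /= addnS big_cons => Zr.
rewrite mulrBr mulrBl !mulrA Zl //; last first.
  by rewrite -cats1; apply: word_cat => // z; rewrite inE => /eqP->.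
by rewrite sub0r -!mulrA [X in - X]mulrA Zr ?oppr0 //; apply: word_cons.
Qed.

End Words.

Section Adjoin.
Variables (F : fieldType) (n : nat) (P : 'M[F]_n -> Prop) (x : 'M[F]_n).
Hypothesis xP : forall w, P w -> P (x * w - w * x).
Implicit Types (s u v : seq 'M[F]_n) (y z : 'M[F]_n).

(** Counts how many letters of P must follow z to annihilate it. Right multiplication by a letter of
    P lowers the index by one, right multiplication by x keeps it, and index 0 means z = 0, by the
    empty word. *)
Let kills k z := forall v, word P v -> (k <= size v)%N -> z * \prod_(w <- v) w = 0.

Let killsD k y z : kills k y -> kills k z -> kills k (y + z).
Proof. by move=> ky kz v Pv le; rewrite mulrDl ky ?kz ?addr0. Qed.

Let killsZ k c z : kills k z -> kills k (c *: z).
Proof. by move=> kz v Pv le; rewrite -mulmxE -scalemxAl mulmxE kz ?scaler0. Qed.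

Let killsW k z : kills k z -> kills k.+1 z.
Proof. by move=> kz v Pv /ltnW; apply: kz. Qed.

Let killsM k z w : P w -> kills k.+1 z -> kills k (z * w).
Proof.
move=> Pw kz v Pv le; have := kz (w :: v) (word_cons Pw Pv) le.
by rewrite big_cons mulrA.
Qed.

(** x is carried rightwards through the word by x w = w x + [x, w], where [x, w] is again a letter
    of P; the number of letters of P never drops. *)
Let killsX k z : kills k z -> kills k (z * x).
Proof.
move=> kz.
have gen v u : word P u -> word P v -> (k <= size u + size v)%N ->
    z * \prod_(w <- u) w * x * \prod_(w <- v) w = 0.
  elim: v u => [|w v IH] u Pu Pv le.
    by rewrite big_nil mulr1 kz ?mul0r // -[size u]addn0.
  have [Pw {}Pv] := word_consE Pv.
  have Puw y : P y -> word P (rcons u y).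
    by move=> Py; rewrite -cats1; apply: word_cat => // z'; rewrite inE => /eqP->.
  have -> : z * \prod_(w <- u) w * x * \prod_(w <- w :: v) w =
      z * (\prod_(w <- rcons u w) w) * x * \prod_(w <- v) w +
      z * (\prod_(w <- rcons u (x * w - w * x) ++ v) w).
    rewrite big_cat big_cons !big_rcons /= mulrBr mulrBl mulrBr !mulrA.
    by rewrite addrC subrK.
  rewrite IH ?size_rcons ?addSnnS //; last exact: Puw.
  rewrite kz ?addr0 //; last by rewrite size_cat size_rcons addSnnS.
  exact: word_cat (Puw _ (xP Pw)) Pv.
by move=> v Pv le; have := gen v [::]; rewrite big_nil mulr1; apply.
Qed.

(** Cut the word into K blocks of length r. When a block is expanded in its letters w + c x, the
    pure power of x is x^r = 0 and every other term contains a letter of P, so each block lowers the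
    index of [kills] by one. It starts at K, for the matrix 1, and ends at 0. *)
Lemma words_vanish_adjoin K r : words_vanish P K -> x ^+ r = 0 ->
  words_vanish (fun y => exists w c, P w /\ y = w + c *: x) (r * K).
Proof.
move=> PK xr; set P' := fun y => _.
have block k z s : kills k.+1 z -> word P' s -> size s = r ->
    kills k (z * \prod_(y <- s) y).
  move=> kz Ps ss.
  suff [c kc] : exists c, kills k (z * \prod_(y <- s) y - c *: (z * x ^+ size s)).
    by move: kc; rewrite ss xr mulr0 scaler0 subr0.
  have kX j : kills k.+1 (z * x ^+ j).
    by elim: j => [|j IH]; rewrite ?mulr1 // exprSr mulrA; apply: killsX.
  elim/last_ind: s Ps {ss} => [|s y IH] Ps.
    by exists 1; rewrite big_nil /= expr0 scale1r subrr => v _ _; rewrite mul0r.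
  have {}IH : exists c, kills k (z * \prod_(y <- s) y - c *: (z * x ^+ size s)).
    by apply: IH => w ws; apply: Ps; rewrite mem_rcons inE ws orbT.
  have [w [d [Pw yE]]] : P' y by apply: Ps; rewrite mem_rcons mem_head.
  have [c kc] := IH; exists (c * d).
  rewrite big_rcons size_rcons /= mulrA.
  set p := z * \prod_(_ <- _) _ in kc *.
  have -> : p * y - (c * d) *: (z * x ^+ (size s).+1) =
      (p - c *: (z * x ^+ size s)) * w + d *: ((p - c *: (z * x ^+ size s)) * x)
      + c *: (z * x ^+ size s * w).
    rewrite yE exprSr mulrDr !mulrBl scalerBr -!mulmxE -!scalemxAl -!scalemxAr.
    rewrite scalerA [d * c]mulrC !mulmxA.
    by rewrite [RHS]addrAC subrK addrA.
  apply: killsD; first apply: killsD.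
  - by apply: killsM => //; apply: killsW.
  - exact/killsZ/killsX.
  - exact/killsZ/killsM.
have blocks k z s : kills k z -> word P' s -> size s = (r * k)%N ->
    kills 0 (z * \prod_(y <- s) y).
  elim: k z s => [|k IH] z s kz Ps.
    by rewrite muln0 => /eqP; rewrite size_eq0 => /eqP->; rewrite big_nil mulr1.
  rewrite mulnS => ss; rewrite -(cat_take_drop r s) big_cat /= mulrA.
  apply: IH.
  - apply: block => //; last by rewrite size_takel // ss leq_addr.
    by move=> w /mem_take /Ps.
  - by move=> w /mem_drop /Ps.
  - by rewrite size_drop ss addKn.
move=> s Ps ss.
have := blocks K 1 s _ Ps ss [::]; rewrite big_nil mulr1 mul1r; apply => // v Pv le.
by rewrite mul1r (words_vanish_ge PK Pv le).
Qed.

End Adjoin.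

Section Engel.
Variables (F : fieldType) (n : nat) (L : 'M[F]_n -> Prop).
Hypotheses (L0 : L 0) (LD : forall c x y, L x -> L y -> L (c *: x + y)).
Hypothesis LB : forall x y, L x -> L y -> L (x * y - y * x).
Hypothesis Lnil : forall x, L x -> x ^+ n = 0.

(* Jacobson's argument: a maximal subalgebra W of L with vanishing words is
   normalised by some x outside W unless W = L, and then x may be adjoined. *)
Lemma engel_words : exists K, words_vanish L K.
Proof.
pose good (W : {vspace 'M[F]_n}) := [/\ forall x, x \in W -> L x,
  forall x y, x \in W -> y \in W -> x * y - y * x \in W &
  exists K, words_vanish (fun x => x \in W) K].
pose D d := `[< exists2 W, good W & \dim W = d >].
have exD : exists d, D d.
  exists 0%N; apply/asboolP; exists 0%VS; last exact: dimv0.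
  split=> [x|x y|]; first by rewrite memv0 => /eqP->.
    by rewrite !memv0 => /eqP-> /eqP->; rewrite mulr0 subrr.
  exists 1%N => -[|y []] // sP _; rewrite big_seq1.
  by have := sP y (mem_head _ _); rewrite memv0 => /eqP.
have bD d : D d -> (d <= \dim {:'M[F]_n})%N.
  by move=> /asboolP[W _ <-]; apply: dimvS (subvf _).
case: (ex_maxnP exD bD) => d /asboolP[W [WL WB [K WK]] <-] maxd.
have [LW|/existsNP[x /not_implyP[Lx xW]]] := pselect (forall x, L x -> x \in W).
  by exists K => s Ls; apply: WK => x /Ls /LW.
(* Brackets with W cannot lead forever through elements of L outside W, as such a chain would reach
   0, which lies in W. Where it stops, y normalises W. *)
have [y [Ly yW] yB] : exists2 y, L y /\ y \notin W &
    forall w, w \in W -> w * y - y * w \in W.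
  apply: contrapT => no.
  suff [] : L 0 /\ 0 \notin W by rewrite mem0v.
  apply: (ad_chain (Q := fun y => L y /\ y \notin W) WK _ (conj Lx _)); last exact/negP.
  move=> y [Ly yW]; apply: contrapT => no'; apply: no; exists y => // w wW.
  apply: contrapT => wy; apply: no'; exists w => //; split; last exact/negP.
  by apply: LB => //; apply: WL.
have W'P z : z \in (W + <[y]>)%VS -> exists w c, w \in W /\ z = w + c *: y.
  by move=> /memv_addP[w wW [_ /vlineP[c ->] ->]]; exists w, c.
have yB' w : w \in W -> y * w - w * y \in W.
  by move=> /yB; rewrite -memvN opprB.
suff /maxd : D (\dim (W + <[y]>)).
  rewrite (geq_leqif (dimv_leqif_sup (addvSl _ _))) => /subvP sub; case/negP: yW; apply: sub.
  exact: (subvP (addvSr _ _)) (memv_line y).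
apply/asboolP; exists (W + <[y]>)%VS => //; split.
- move=> z /W'P[w [c [wW ->]]]; rewrite addrC; apply: LD => //; exact: WL.
- move=> z z' /W'P[w [c [wW ->]]] /W'P[w' [c' [w'W ->]]].
  have -> : (w + c *: y) * (w' + c' *: y) - (w' + c' *: y) * (w + c *: y) =
      (w * w' - w' * w) + (c' *: (w * y - y * w) + c *: (y * w' - w' * y)).
    rewrite -!mulmxE !mulmxDl !mulmxDr -!scalemxAl -!scalemxAr !scalerA.
    rewrite [c' * c]mulrC !scalerBr !opprD !addrA.
    by rewrite [LHS](ACl (1*5*2*7*3*6*(4*8)))/= subrr addr0.
  apply: (subvP (addvSl _ _)); rewrite memvD ?WB // memvD // memvZ //.
    exact: yB.
  exact: yB'.
- exists (n * K)%N => s sP; apply: (words_vanish_adjoin yB' WK (Lnil Ly)).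
  by move=> z /sP /W'P[w [c [wW ->]]]; exists w, c.
Qed.

(** A chain of nonzero brackets with elements of L must stop, and its last member commutes with all
    of L. *)
Lemma engel_center x : L x -> x != 0 ->
  exists z, [/\ L z, z != 0 & forall w, L w -> comm_mx w z].
Proof.
move=> Lx x0; have [K LK] := engel_words; apply: contrapT => no.
suff [_] : L 0 /\ 0 != 0 :> 'M[F]_n by rewrite eqxx.
apply: (ad_chain (Q := fun y => L y /\ y != 0) LK _ (conj Lx x0)).
move=> y [Ly y0]; apply: contrapT => no'; apply: no; exists y; split => // w Lw.
apply: contrapT => wy; apply: no'; exists w => //; split; first exact: LB.
by rewrite subr_eq0; apply/eqP.
Qed.

End Engel.

(** * Restriction of polynomials to lines *)

Section Line.
Variables (F : numClosedFieldType) (n : nat) (S : comNzRingType).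
Variables (a : {rmorphism F -> S}) (x q : 'I_n -> S).
Local Notation poly := {mpoly F[n]}.
Implicit Types (f g : poly).

(* The restriction of f to the line s |-> x + s q. *)
Definition line : poly -> {poly S} :=
  mmap (polyC \o a) (fun i => (x i)%:P + q i *: 'X).
HB.instance Definition _ := GRing.RMorphism.on line.

Lemma lineC c : line (mpolyC n c) = (a c)%:P.
Proof. exact: mmapC. Qed.

Lemma lineX i : line (var i) = (x i)%:P + q i *: 'X.
Proof. by rewrite /line mmapX mmap1U. Qed.

Lemma deriv_line f : (line f)^`() = \sum_i q i *: line (mderiv i f).
Proof.
rewrite (@chain_rule _ _ _ line (fun f => (line f)^`())).
- apply: eq_bigr => i _.
  by rewrite lineX derivD derivC derivZ derivX add0r -scalerAr mulr1.
- by move=> g h; rewrite rmorphD derivD.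
- by move=> c; rewrite lineC derivC.
- by move=> g h; rewrite rmorphM derivM.
Qed.

Lemma horner_line f t : (line f).[t] = mmap a (fun i => x i + q i * t) f.
Proof.
rewrite -[LHS]/((horner_eval t \o line) f).
move: f; apply: eq_rmorph_mpoly => [c|i] /=; rewrite /horner_eval.
  by rewrite lineC hornerC mmapC.
by rewrite lineX mmapX mmap1U !hornerE.
Qed.

Lemma line_monom (m : multinom n) : (size (line (mpolyX _ m)) <= (mdeg m).+1)%N /\
  (line (mpolyX _ m))`_(mdeg m) = mmap1 q m.
Proof.
rewrite /line mmapX /mmap1 mdegE.
elim/big_rec3: _ => [|i b p d _ [sp pE]]; first by rewrite size_poly1 coefC.
set l := (x i)%:P + _.
have lk k : (size (l ^+ k) <= k.+1)%N /\ (l ^+ k)`_k = q i ^+ k.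
  elim: k => [|k [sk kE]]; first by rewrite expr0 size_poly1 coefC.
  have sl : (size l <= 2)%N.
    rewrite (leq_trans (size_polyD _ _)) // geq_max (leq_trans (size_polyC_leq1 _)) //.
    by rewrite (leq_trans (size_scale_leq _ _)) // size_polyX.
  rewrite !exprS; split.
    apply: (leq_trans (size_polyMleq _ _)); move: (leq_add sl sk).
    by rewrite add2n => le; rewrite -subn1 leq_subLR add1n.
  rewrite /l mulrDl coefD mul_polyC coefZ [_`_k.+1]nth_default // mulr0 add0r.
  by rewrite -scalerAl coefZ coefXM /= kE.
have [sl lE] := lk (m i); split.
  apply: (leq_trans (size_polyMleq _ _)); move: (leq_add sl sp).
  by rewrite addSn addnS => le; rewrite -subn1 leq_subLR add1n.
rewrite coefM; move: lE pE sl sp => <- <- sl sp.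
rewrite (bigD1 (inord (m i))) //= inordK ?ltnS ?leq_addr // addKn.
rewrite big1 ?addr0 // => j; rewrite -val_eqE /= inordK ?ltnS ?leq_addr // => ji.
have [jm|mj|/eqP] := ltngtP j (m i); last by rewrite (negbTE ji).
  rewrite [_`_(_ - _)]nth_default ?mulr0 //; apply: (leq_trans sp).
  by rewrite ltn_subRL ltn_add2r.
by rewrite nth_default ?mul0r // (leq_trans sl).
Qed.

Lemma size_line f : (size (line f) <= mmeasure mdeg f)%N.
Proof.
rewrite {1}[f]mpolyE raddf_sum /=.
apply: (leq_trans (size_sum _ _ _)); rewrite big_seq.
apply/bigmax_leqP_seq => m _ mf; rewrite -mul_mpolyC rmorphM /= lineC mul_polyC.
apply: (leq_trans (size_scale_leq _ _)).
by apply: (leq_trans (line_monom m).1); apply: mmeasure_mnm_lt.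
Qed.

Lemma coef_line f d : (mmeasure mdeg f <= d.+1)%N ->
  (line f)`_d = mmap a q (pihomog mdeg d f).
Proof.
move=> fd; rewrite {1}[f]mpolyE !raddf_sum /= coef_sum.
rewrite [RHS]big_mkcond !big_seq; apply: eq_bigr => m mf /=.
rewrite -mul_mpolyC rmorphM /= lineC mul_polyC coefZ.
have [sm cm] := line_monom m.
case: eqVneq => [<-|md]; first by rewrite cm rmorphM /= mmapC mmapX.
rewrite nth_default ?mulr0 //; apply: (leq_trans sm).
rewrite ltn_neqAle md -ltnS (leq_trans _ fd) //; exact: mmeasure_mnm_lt.
Qed.

End Line.

(** * Points where a polynomial is nonzero, directions where its leading form is *)

Section NonRoot.
Variables (F : numClosedFieldType) (n : nat).
Local Notation poly := {mpoly F[n]}.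
Implicit Types (f g : poly).

Lemma msize_mderiv i f : (mmeasure mdeg (mderiv i f) <= (mmeasure mdeg f).-1)%N.
Proof.
have [->|f0] := eqVneq f 0; first by rewrite mderiv0 mmeasure0.
rewrite mmeasureE; apply/bigmax_leqP_seq => m.
rewrite mcoeff_msupp mcoeff_deriv => mE _.
have : mnm_add m (mnm1 i) \in msupp f.
  by rewrite mcoeff_msupp; apply: contra_neq mE => ->; rewrite mul0rn.
by move=> /msize_mdeg_lt; rewrite mdegD mdeg1 addn1; case: (mmeasure _ f).
Qed.

(** Induction on the degree: if f vanishes everywhere, so do its partial derivatives, being
    derivatives along coordinate lines; the one in a variable of the leading monomial is nonzero in
    characteristic 0. *)
Lemma mpoly_nonroot f : f != 0 -> exists x : 'I_n -> F, meval x f != 0.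
Proof.
move=> f0; apply: contrapT => /forallNP no.
have {no} : forall x, meval x f = 0.
  by move=> x; apply/eqP; apply/negP => /negP; apply: no.
elim: {f}_.+1 {-2}f (ltnSn (mmeasure mdeg f)) f0 => // k IH f fk f0 fz.
have [f1|f1] := leqP (mmeasure mdeg f) 1.
  move: f0 (fz (fun=> 0)); rewrite (msize1_polyC f1) mevalC.
  by rewrite mpolyC_eq0 => /eqP.
have lf := mlead_supp f0.
have [i mi] : exists i, mlead f i != 0%N.
  apply: contrapT => /forallNP no; move: f1; rewrite -mlead_deg // mdegE.
  by rewrite big1 // => i _; apply/eqP; apply/negP => /negP; apply: no.
apply: (IH (mderiv i f)).
- apply: (leq_ltn_trans (msize_mderiv i f)).
  by rewrite -ltnS (ltn_predK f1).
- apply: contraNneq mi => fi.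
  move: (congr1 (mcoeff (mnm_sub (mlead f) (mnm1 i))) fi).
  rewrite mcoeff0 mcoeff_deriv.
  have [//|mi] := eqVneq (mlead f i) 0%N.
  rewrite submK ?lep1mP // => /eqP; rewrite mulrn_eq0 /= mleadc_eq0.
  by rewrite (negbTE f0).
- move=> x.
  have : line idfun x (fun j => (i == j)%:R) f = 0.
    apply/eqP; apply/closed_nonrootP => -[t]; rewrite rootE horner_line.
    by rewrite -/(meval _ f) fz eqxx.
  move/(congr1 (fun p => p^`().[0])); rewrite deriv0 horner0 deriv_line.
  rewrite (bigD1 i) //= eqxx scale1r big1 ?addr0 => [|j /negbTE ji]; last first.
    by rewrite eq_sym ji scale0r.
  rewrite horner_line => <-; apply: meval_eq => j.
  by rewrite mulr0 addr0.
Qed.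

Lemma mpoly_eq_meval f g : (forall x, meval x f = meval x g) -> f = g.
Proof.
move=> fg; apply/eqP; rewrite -subr_eq0; apply/negP => /negP /mpoly_nonroot[x].
by rewrite mevalB fg subrr eqxx.
Qed.

(** Take q where the leading homogeneous form of f is nonzero. Its value there is the top
    coefficient on every line of direction q, whatever the base point. *)
Lemma line_lead_const f : f != 0 -> exists (q : 'I_n -> F) (c : F),
  c != 0 /\ forall (S : comNzRingType) (a : {rmorphism F -> S}) x,
    lead_coef (line a x (a \o q) f) = a c.
Proof.
move=> f0; pose d := (mmeasure mdeg f).-1.
have dE : mmeasure mdeg f = d.+1 by rewrite -mpolySpred.
have /mpoly_nonroot[q qc] : pihomog mdeg d f != 0.
  apply/eqP => /(congr1 (mcoeff (mlead f))); rewrite mcoeff0 /pihomog raddf_sum /=.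
  have lf := mlead_supp f0.
  rewrite big_mkcond (bigD1_seq (mlead f)) ?msupp_uniq //=.
  rewrite /d -mlead_deg //= eqxx mcoeffZ mcoeffX eqxx mulr1 big1 ?addr0.
    by move=> /eqP; rewrite mleadc_eq0 (negbTE f0).
  move=> m /negbTE ml; case: ifP => // _.
  by rewrite mcoeffZ mcoeffX ml mulr0.
exists q, (meval q (pihomog mdeg d f)); split=> // S a x.
have cE : (line a x (a \o q) f)`_d = a (meval q (pihomog mdeg d f)).
  rewrite coef_line ?dE // -[RHS]/((a \o meval q) _).
  move: (pihomog _ _ _); apply: eq_rmorph_mpoly => [c|i] /=.
    by rewrite mmapC mevalC.
  by rewrite mmapX mmap1U mevalXU.
rewrite lead_coefE -cE.
suff -> : size (line a x (a \o q) f) = d.+1 by [].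
apply/eqP; rewrite eqn_leq -{1}dE size_line ltnNge; apply/negP => le.
by move: cE; rewrite nth_default // => /esym/eqP; rewrite fmorph_eq0 (negbTE qc).
Qed.

End NonRoot.

(** * Saito's criterion *)

Section Determinants.

(** The matrix determinant lemma, multiplied by a so that no division occurs; the two sides come
    from two block eliminations of the same matrix. *)
Lemma det_scalar_add_rank1 (R : comPzRingType) n (a : R) (u : 'cV[R]_n) (v : 'rV[R]_n) :
  a * \det (a%:M + u *m v) = a ^+ n * (a + (v *m u) 0 0).
Proof.
pose M := block_mx a%:M (- u) v (1%:M : 'M_1).
have M1 : \det M = \det (a%:M + u *m v).
  have := det_mulmx M (block_mx 1%:M 0 (- v) 1%:M).
  rewrite det_lblock !det1 !mulr1 => <-; rewrite /M mulmx_block.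
  rewrite !mulmx1 !mulmx0 !mul1mx addrN !add0r mulmxN mulNmx opprK.
  by rewrite det_ublock det1 mulr1.
have M2 : \det M * a = a ^+ n * (a + (v *m u) 0 0).
  have := det_mulmx M (block_mx 1%:M u 0 a%:M).
  rewrite det_ublock det1 mul1r det_scalar1 => <-; rewrite /M mulmx_block.
  rewrite !mulmx1 !mulmx0 !mul1mx !addr0 mul_scalar_mx mul_mx_scalar scalerN addrN.
  rewrite det_lblock det_scalar det_mx11 !mxE eqxx mulr1n [_ + a]addrC.
  by [].
by rewrite -M1 mulrC.
Qed.

Lemma tall_mx_kernel (R : idomainType) m n (A : 'M[R]_(m, n)) : (n < m)%N ->
  exists2 v : 'rV[R]_m, v != 0 & v *m A = 0.
Proof.
move=> /subnKC nm; set k := (m - n.+1)%N in nm.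
have {}nm : (n + k.+1 = m)%N by rewrite addnS -addSn.
case: _ / nm A => A.
pose A' : 'M[R]_(n + k.+1) := row_mx A 0.
have /eqP/det0P[v v0 vA] : \det A' = 0.
  rewrite (expand_det_col _ (rshift n ord0)) big1 // => i _.
  by rewrite row_mxEr mxE mul0r.
exists v => //; move: (congr1 lsubmx vA).
by rewrite mul_mx_row row_mxKl linear0.
Qed.

End Determinants.

Lemma polyC_cross_mul (A : idomainType) (f g : {poly A}) c d a b :
  c != 0 -> c *: f = d *: g -> c * b = d * a -> a%:P * f = b%:P * g.
Proof.
move=> c0 fg cd; apply: (@mulfI _ c%:P); first by rewrite polyC_eq0.
by rewrite mulrCA [c%:P * f]mul_polyC fg -mul_polyC !mulrA -!polyCM cd [a * d]mulrC.
Qed.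

Section RadicalPoly.
Variables (A : idomainType) (h : A).
Hypothesis hrad : forall f, (exists q, f ^+ 2 = q * h) -> exists q, f = q * h.

(** The constant term c of the polynomial has its square in (h), hence lies in (h). Removing it
    leaves f X, and the square of f X can be divided by X^2, which lowers the degree. *)
Lemma radical_polyC (f : {poly A}) :
  (exists t, f ^+ 2 = t * h%:P) -> exists t, f = t * h%:P.
Proof.
elim/poly_ind: f => [|f c IH] [t tE]; first by exists 0; rewrite mul0r.
have [q qE] : exists q, c = q * h.
  apply: hrad; exists t.[0]; move: (congr1 (fun p => p.[0]) tE).
  by rewrite /= !expr2 !hornerM hornerD hornerMX !hornerC mulr0 add0r.
have [|g gE] := IH.
  pose t' := t - q%:P * (2%:R * f * 'X + c%:P).
  exists (drop_poly 2 t'); apply/polyP => i.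
  rewrite coefMC coef_drop_poly -coefMC.
  have -> : t' * h%:P = f ^+ 2 * 'X^2.
    rewrite /t' mulrBl -tE qE polyCM; ring.
  by rewrite coefMXn addnK; case: ltnP => //; rewrite ltnNge leq_addl.
by exists (g * 'X + q%:P); rewrite gE qE polyCM; ring.
Qed.

End RadicalPoly.

Section Saito.
Import Pdiv.CommonIdomain Pdiv.Idomain Pdiv.WeakIdomain.
Variables (F : numClosedFieldType) (n : nat).
Local Notation poly := {mpoly F[n]}.
Implicit Types (f g h : poly) (q : 'I_n -> F).

Local Notation C := (@mpolyC n F).
(** The base point is generic, its coordinates being the variables: [gline q f] is f(x + s q), a
    polynomial in s over the polynomials in x. *)
Local Notation gline q := (line C (fun i => var i) (C \o q)).

Lemma gline_at0 q f : (gline q f).[0] = f.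
Proof.
rewrite -[LHS]/((horner_eval 0 \o gline q) f) -[RHS]/(idfun f).
move: f; apply: eq_rmorph_mpoly => [c|i] /=; rewrite /horner_eval.
  by rewrite lineC hornerC.
by rewrite lineX !hornerE.
Qed.

Definition vder (X : 'rV[poly]_n) f : poly := \sum_i X 0 i * mderiv i f.

Definition dirder q f := vder (\row_i C (q i)) f.

Lemma deriv_gline q f : (gline q f)^`() = gline q (dirder q f).
Proof.
rewrite deriv_line rmorph_sum; apply: eq_bigr => i _ /=.
by rewrite mxE rmorphM /= lineC mul_polyC.
Qed.

(* The automorphism x |-> x + s q, s |-> s of the ring of polynomials in s. *)
Definition is_shear q (phi : {rmorphism {poly poly} -> {poly poly}}) :=
  phi 'X = 'X /\ forall f, phi f%:P = gline q f.

Lemma ex_shear q : exists phi, is_shear q phi.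
Proof.
exists (horner_eval 'X \o map_poly (gline q)); split=> [|f] /=.
  by rewrite map_polyX /horner_eval hornerX.
by rewrite map_polyC /horner_eval hornerC.
Qed.

Lemma shearK q q' phi psi : is_shear q phi -> is_shear q' psi ->
  (forall i, q i + q' i = 0) -> cancel psi phi.
Proof.
move=> [phiX phiE] [psiX psiE] qq' p.
elim/poly_ind: p => [|p f IH]; first by rewrite (raddf0 psi) (raddf0 phi).
rewrite (rmorphD psi) (rmorphD phi) (rmorphM psi) (rmorphM phi) IH psiX phiX.
congr (_ + _); rewrite psiE -[LHS]/((phi \o gline q') f) -[RHS]/(polyC f).
move: f; apply: eq_rmorph_mpoly => [c|i]; rewrite [LHS]/=.
  by rewrite lineC phiE lineC.
rewrite lineX -mul_polyC (rmorphD phi) (rmorphM phi) !phiE phiX lineX lineC.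
by rewrite -mul_polyC -addrA -mulrDl -polyCD -mpolyCD qq' mpolyC0 mul0r addr0.
Qed.

Definition radical_gen h := forall f, (exists g, f ^+ 2 = g * h) -> exists g, f = g * h.

(** The shear carries the constant polynomial h to [gline q h] and is invertible, so [radical_polyC]
    is transported along it. *)
Lemma radical_gline q h (p : {poly poly}) : radical_gen h ->
  (exists t, p ^+ 2 = t * gline q h) -> exists t, p = t * gline q h.
Proof.
move=> hrad [t pE].
have [phi phiP] := ex_shear q; have [psi psiP] := ex_shear (fun i => - q i).
have phiK : cancel phi psi by apply: (shearK psiP phiP) => i; rewrite addNr.
have psiK : cancel psi phi by apply: (shearK phiP psiP) => i; rewrite subrr.
have [_ phiE] := phiP.
have [|g gE] := @radical_polyC _ h hrad (psi p).
  by exists (psi t); rewrite -(rmorphXn psi) pE (rmorphM psi) -phiE phiK.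
by exists (phi g); rewrite -phiE -(rmorphM phi) -gE psiK.
Qed.

Lemma deriv_neq0 (u : {poly poly}) : (1 < size u)%N -> u^`() != 0.
Proof.
move=> su; apply/eqP => /(congr1 (fun p : {poly poly} => p`_(size u).-2)).
rewrite coef_deriv coef0.
have -> : (size u).-2.+1 = (size u).-1 by case: (size u) su => [|[]].
rewrite -lead_coefE -scaler_nat => /eqP.
rewrite -mul_mpolyC mulf_eq0 mpolyC_eq0 pnatr_eq0 lead_coef_eq0 -size_poly_eq0.
by case: (size u) su => [|[]].
Qed.

(** Let H be the restriction of h. Divisibility over a domain allows a nonzero multiplier: c H = v
    u^2. Then (u v)^2 is a multiple of H, so u v = t H by radicality, and c H = t u H forces u to be
    constant in s. *)
Lemma separable_gline q h : h != 0 -> radical_gen h -> lead_coef (gline q h) != 0 ->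
  coprimep (gline q h) (gline q h)^`().
Proof.
move=> h0 hrad H0; have {}H0 : gline q h != 0 by rewrite -lead_coef_eq0.
suff : separable_poly (gline q h) by rewrite separable_poly.unlock.
apply/separable_polyP; split; last by move=> u _; apply: deriv_neq0.
apply/poly_square_freeP => u su; apply/negP => /dvdpP[[c v] /= c0 cE].
have [t tE] : exists t, u * v = t * gline q h.
  apply: radical_gline => //; exists (v * c%:P).
  by rewrite -mulrA mul_polyC cE; ring.
have u0 : u != 0.
  apply: contra_neq H0 => u0; move: cE; rewrite u0 expr0n /= mulr0 => /eqP.
  by rewrite -mul_polyC mulf_eq0 polyC_eq0 (negbTE c0) => /eqP.
have : c%:P * gline q h = (t * u) * gline q h.
  by rewrite mul_polyC cE mulrAC -tE; ring.
move/(mulIf H0) => /(congr1 (fun p : {poly poly} => size p)).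
rewrite size_polyC c0 => /esym/eqP; have [->|t0] := eqVneq t 0.
  by rewrite mul0r size_poly0.
rewrite size_mul //; move: t0 u0 su; rewrite -!size_poly_eq0.
by case: (size t) => [|a]; case: (size u) => [|[|b]] //; rewrite !addnS.
Qed.

Section Basis.
Variables (h : poly).
Hypotheses (h0 : h != 0) (hrad : radical_gen h).
Hypothesis h_nonconst : (1 < mmeasure mdeg h)%N.

Definition in_der (X : 'rV[poly]_n) := exists g, vder X h = g * h.

Definition basis_der m (B : 'M[poly]_(m, n)) :=
  [/\ forall j, in_der (row j B), forall X, in_der X -> exists c : 'rV_m, X = c *m B &
      forall c : 'rV_m, c *m B = 0 -> c = 0].

Lemma vder_row_mul m (A : 'M[poly]_(m, n)) f j :
  vder (row j A) f = (A *m \col_i mderiv i f) j 0.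
Proof. by rewrite mxE; apply: eq_bigr => i _; rewrite !mxE. Qed.

Lemma in_der_rows m p (B : 'M[poly]_(m, n)) (A : 'M[poly]_(p, n)) :
  basis_der B -> (forall j, in_der (row j A)) -> exists E, A = E *m B.
Proof.
move=> [_ Bgen _] derA.
have /choice[c cE] : forall j, exists c : 'rV_m, row j A = c *m B.
  by move=> j; apply: Bgen.
exists (\matrix_j c j); apply/row_matrixP => j.
by rewrite row_mul rowK.
Qed.

Lemma in_der_h_scalar : forall j, in_der (row j h%:M).
Proof.
move=> j; exists (mderiv j h); rewrite vder_row_mul mul_scalar_mx !mxE.
by rewrite mulrC.
Qed.

(** Every h d/dx_j is logarithmic, so h I = E B. A left kernel vector of E would kill h I, and one
    of B contradicts freeness. *)
Lemma basis_der_card m (B : 'M[poly]_(m, n)) : basis_der B -> m = n.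
Proof.
move=> bB; have [_ _ Bfree] := bB.
have [E hE] := in_der_rows bB in_der_h_scalar.
apply/eqP; rewrite eqn_leq; apply/andP; split; rewrite leqNgt; apply/negP => lt.
  have [v v0 vB] := tall_mx_kernel B lt.
  by move: v0; rewrite (Bfree v vB) eqxx.
have [v v0 vE] := tall_mx_kernel E lt.
move: (congr1 (mulmx v) hE); rewrite mulmxA vE mul0mx mul_mx_scalar => /eqP.
by rewrite scalemx_eq0 (negbTE h0) (negbTE v0).
Qed.

(** D = det B and h are shown to divide each other along the generic line. Up to multipliers this
    only says c1 D = c2 h with c1, c2 polynomials in x; the leading coefficients in s, both
    constants, turn the ratio into a constant, and s = 0 returns to D and h. *)
Lemma saito (B : 'M[poly]_n) : basis_der B ->
  exists2 c, c != 0 & \det B = c *: h.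
Proof.
move=> bB; have [Bder _ _] := bB.
pose D := \det B.
have [q [a [a0 qa]]] := line_lead_const h0.
have H_lead : lead_coef (gline q h) = C a by apply: qa.
have Ca0 : C a != 0 by rewrite mpolyC_eq0.
have cop := separable_gline h0 hrad (q := q); rewrite H_lead in cop.
have {}cop := cop Ca0; rewrite deriv_gline in cop.
have [E hE] := in_der_rows bB in_der_h_scalar.
have hnD : h ^+ n = \det E * D by rewrite -det_mulmx -hE det_scalar.
(* h divides D * dirder q h, from Cramer's rule. *)
have HD : gline q h %| gline q D.
  rewrite -(Gauss_dvdpl _ cop) -rmorphM /=.
  have /choice[g gE] : forall j, exists g, (B *m \col_i mderiv i h) j 0 = g * h.
    by move=> j; have [g gE] := Bder j; exists g; rewrite -gE vder_row_mul.
  have gradE : B *m \col_i mderiv i h = h *: \col_i g i.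
    by apply/colP => j; rewrite gE !mxE mulrC.
  have DE : D *: \col_i mderiv i h = h *: (\adj B *m \col_i g i).
    by rewrite -mul_scalar_mx -mul_adj_mx -mulmxA gradE scalemxAr.
  have -> : D * dirder q h = h * ((\row_i C (q i)) *m (\adj B *m \col_i g i)) 0 0.
    transitivity (((\row_i C (q i)) *m (D *: \col_i mderiv i h)) 0 0).
      rewrite -scalemxAr [RHS]mxE; congr (_ * _).
      by rewrite mxE; apply: eq_bigr => i _; rewrite !mxE.
    by rewrite DE -scalemxAr mxE.
  by rewrite rmorphM /= dvdp_mulr.
have [i qi] : exists i, q i != 0.
  apply: contrapT => /forallNP q0; move: H_lead h_nonconst.
  have -> : gline q h = h%:P.
    rewrite -[RHS]/(polyC h); move: (h); apply: eq_rmorph_mpoly => [c|i].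
      by rewrite /= lineC.
    rewrite /= lineX /=; have /negP := q0 i; rewrite negbK => /eqP->.
    by rewrite mpolyC0 scale0r addr0.
  by rewrite lead_coefC => ->; rewrite mmeasureC; case: eqP.
have DH : gline q D %| gline q h.
  pose v : 'rV[poly]_n := \row_j C (q j).
  pose grad : 'cV[poly]_n := \col_j mderiv j h.
  pose r : 'cV[poly]_n := \col_j C ((q i)^-1 *+ (j == i)).
  have vr : (v *m r) 0 0 = 1.
    rewrite mxE (bigD1 i) //= !mxE eqxx mulr1n -mpolyCM mulfV // big1 ?addr0 //.
    by move=> j /negbTE ji; rewrite !mxE ji mulr0n mpolyC0 mulr0.
  have vgrad : (v *m grad) 0 0 = dirder q h.
    by rewrite mxE; apply: eq_bigr => j _; rewrite !mxE.
  (* Row j is the field (d_q h) d_j + (h r_j - d_j h) q, which sends h to r_j (d_q h) h. As v r = 1,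
     the determinant of M times d_q h is h (d_q h)^n. So D divides h times a power of d_q h, and D
     is coprime to d_q h along the line because it divides h^n. *)
  pose M := (dirder q h)%:M + (h *: r - grad) *m v.
  have [j|E' ME] := in_der_rows bB (A := M).
    exists (dirder q h * r j 0); rewrite vder_row_mul -/grad mulmxDl -mulmxA.
    rewrite [v *m grad]mx11_scalar vgrad mul_mx_scalar mul_scalar_mx -scalerDr.
    by rewrite addrC subrK !mxE; ring.
  have := det_scalar_add_rank1 (dirder q h) (h *: r - grad) v.
  rewrite -/M ME det_mulmx mulmxBr -scalemxAr mxE [X in _ + (X + _)]mxE.
  rewrite [X in _ + (_ + X)]mxE vr vgrad mulr1 addrC subrK => detE.
  have : gline q D %| gline q h * gline q (dirder q h) ^+ n.
    rewrite -rmorphXn -rmorphM /= [h * _]mulrC -detE mulrA rmorphM /=.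
    exact/dvdp_mull/dvdpp.
  rewrite Gauss_dvdpl //; apply: coprimep_expr.
  apply: (@coprimep_dvdr _ (gline q h ^+ n)); last exact: coprimep_expl.
  rewrite -rmorphXn hnD rmorphM; exact/dvdp_mull/dvdpp.
have /eqpP[[c1 c2] /= /andP[c10 c20] cE] : gline q D %= gline q h.
  by apply/andP; split; [exact: DH | exact: HD].
(* From h^n = det E * D, the leading coefficient of D in s divides the constant a^n, hence is a
   unit. *)
have [b [b0 bE]] : exists b, b != 0 /\ lead_coef (gline q D) = C b.
  have : lead_coef (gline q D) \is a GRing.unit.
    have : C (a ^+ n) \is a GRing.unit.
      by apply: rmorph_unit; rewrite unitfE expf_neq0.
    have -> : C (a ^+ n) = lead_coef (gline q (\det E)) * lead_coef (gline q D).
      by rewrite -lead_coefM -rmorphM -hnD !rmorphXn /= lead_coef_exp H_lead.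
    by rewrite unitrM => /andP[].
  rewrite unfold_in => /andP[/eqP bE b0]; exists (mcoeff mnm0 (lead_coef (gline q D))).
  by split; [rewrite -unitfE | exact: bE].
have cab : c1 * C b = c2 * C a.
  rewrite -bE -H_lead -[X in X * _ = _](lead_coefC c1).
  by rewrite -[X in _ = X * _](lead_coefC c2) -!lead_coefM !mul_polyC cE.
exists (b / a); first by rewrite mulf_neq0 ?invr_eq0.
have gE : gline q (C a * D) = gline q (C b * h).
  rewrite !rmorphM [X in X * _ = _]lineC [X in _ = X * _]lineC.
  exact: polyC_cross_mul c10 cE cab.
have aD : C a * D = C b * h.
  exact: etrans (esym (gline_at0 q _)) (etrans (congr1 (fun p => p.[0]) gE) (gline_at0 q _)).
have {}aD : a *: D = b *: h.
  exact: etrans (esym (mul_mpolyC a D)) (etrans aD (mul_mpolyC b h)).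
by rewrite -/D -[D]scale1r -(mulVf a0) -scalerA aD scalerA [a^-1 * b]mulrC.
Qed.

End Basis.
End Saito.

(** * The trace form on the Lie algebra *)

Section LinearForms.
Variables (F : numClosedFieldType) (n : nat).
Local Notation poly := {mpoly F[n]}.
Implicit Types (f h p : poly) (A B : 'M[F]_n).

Lemma mcoeffU_deriv f (k : 'I_n) : mcoeff (mnm1 k) f = mcoeff mnm0 (mderiv k f).
Proof. by rewrite mcoeff_deriv add0m mnm0E mulr1n. Qed.

Lemma mcoeffU_lin_form A i k : mcoeff (mnm1 k) (lin_form A i) = A i k.
Proof.
rewrite raddf_sum (bigD1 k) //= mcoeffZ mcoeffX eqxx mulr1 big1 ?addr0 // => j jk.
by rewrite mcoeffZ mcoeffX eq_mnm1 (negbTE jk) mulr0.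
Qed.

Lemma mcoeff0_lin_form A i : mcoeff mnm0 (lin_form A i) = 0.
Proof.
rewrite raddf_sum big1 // => j _ /=.
by rewrite mcoeffZ mcoeffX mnm1_eq0 mulr0.
Qed.

Lemma mcoeffU_mul_lin_form p A i k :
  mcoeff (mnm1 k) (p * lin_form A i) = mcoeff mnm0 p * A i k.
Proof.
rewrite mcoeffU_deriv mderivM raddfD /= !rmorphM /= mcoeff0_lin_form mulr0 add0r.
by rewrite -mcoeffU_deriv mcoeffU_lin_form.
Qed.

Lemma homog1_lin_form (b : 'rV[poly]_n) : (forall i, b 0 i \is ishomog1 1%N mdeg) ->
  b = \row_i lin_form (\matrix_(i, k) mcoeff (mnm1 k) (b 0 i)) i.
Proof.
move=> bh; apply/rowP => i; rewrite [RHS]mxE; apply/mpolyP => m.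
have [/mdeg1P[k /eqP->]|m1] := boolP (mdeg m == 1%N).
  by rewrite mcoeffU_lin_form mxE.
rewrite (dhomog_nemf_coeff (bh i) m1) raddf_sum big1 // => k _ /=.
rewrite mcoeffZ mcoeffX; case: eqP => [km|]; last by rewrite mulr0.
by move: m1; rewrite -km mdeg1 eqxx.
Qed.

Lemma msize_lder A h : (mmeasure mdeg (lder A h) <= mmeasure mdeg h)%N.
Proof.
apply: (leq_trans (mmeasure_sum _ _ _ _)); apply/bigmax_leqP => i _.
have [->|l0] := eqVneq (lin_form A i) 0; first by rewrite mul0r mmeasure0.
have [->|d0] := eqVneq (mderiv i h) 0; first by rewrite mulr0 mmeasure0.
have l2 : (mmeasure mdeg (lin_form A i) <= 2)%N.
  apply: (leq_trans (mmeasure_sum _ _ _ _)); apply/bigmax_leqP => k _.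
  by apply: (leq_trans (mmeasureZ_le _ _ _)); rewrite msizeX mdeg1.
rewrite msizeM //; have := leq_add l2 (msize_mderiv i h).
have : (0 < mmeasure mdeg (mderiv i h))%N by rewrite lt0n mmeasure_poly_eq0.
have := msize_mderiv i h.
move: (mmeasure _ (lin_form _ _)) (mmeasure _ (mderiv _ _)) (mmeasure _ h).
by move=> a b [|c] //=; [case: b | rewrite add2n; case: (a + b)%N].
Qed.

(** [lder A] does not raise the degree, so the multiplier g is a constant. *)
Lemma lder_in_ideal A h g : h != 0 -> lder A h = g * h ->
  exists c, lder A h = c *: h.
Proof.
move=> h0 Ah; have [g0|g0] := eqVneq g 0.
  by exists 0; rewrite Ah g0 mul0r scale0r.
exists (mcoeff mnm0 g); rewrite -mul_mpolyC -msize1_polyC //.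
have := msize_lder A h; rewrite Ah msizeM //.
have : (0 < mmeasure mdeg h)%N by rewrite lt0n mmeasure_poly_eq0.
move: (mmeasure _ g) (mmeasure _ h) => a [|b] // _.
by rewrite addnS /= -[X in (_ <= X)%N]add1n leq_add2r.
Qed.

Lemma meval_lsubst g f (x : 'cV[F]_n) :
  meval (fun i => x i 0) (lsubst g f) = meval (fun i => (g *m x) i 0) f.
Proof.
rewrite -[LHS]/((meval (fun i => x i 0) \o lsubst g) f).
move: f; apply: eq_rmorph_mpoly => [c|i] /=.
  by rewrite lsubstC !mevalC.
rewrite lsubstX mevalXU raddf_sum mxE; apply: eq_bigr => k _ /=.
by rewrite mevalZ mevalXU.
Qed.

End LinearForms.

Section LieAlgebra.
Variables (F : numClosedFieldType) (n : nat) (h : {mpoly F[n]}).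
Hypothesis h0 : h != 0.
Implicit Types (A B X Y Z W g : 'M[F]_n).

(* The Lie algebra of the logarithmic vector fields of weight zero. *)
Definition log_lie A := exists c, lder A h = c *: h.

Lemma log_lie_lin c A B : log_lie A -> log_lie B -> log_lie (c *: A + B).
Proof.
move=> [a Aa] [b Bb]; exists (c * a + b).
by rewrite lderD lderZ Aa Bb scalerA scalerDl.
Qed.

Lemma log_lie_bracket A B : log_lie A -> log_lie B -> log_lie (A *m B - B *m A).
Proof.
move=> [a Aa] [b Bb]; exists 0; rewrite -lder_comm Aa Bb.
rewrite [lder B _]linearZ [lder A _]linearZ /= Aa Bb.
by rewrite !scalerA mulrC subrr scale0r.
Qed.

Lemma lder_conj g A c chi : g \in unitmx -> lsubst g h = chi *: h ->
  lder A h = c *: h -> lder (g *m A *m invmx g) h = c *: h.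
Proof.
move=> ug gh Ac; apply: (lsubst_inj ug).
by rewrite -lder_lsubst_conj // gh !linearZ /= Ac gh !scalerA mulrC.
Qed.

Lemma lsubst_inv g chi : g \in unitmx -> chi != 0 -> lsubst g h = chi *: h ->
  lsubst (invmx g) h = chi^-1 *: h.
Proof.
move=> ug chi0 gh; apply: (lsubst_inj ug).
by rewrite lsubstM mulVmx // lsubst1 linearZ /= gh scalerA mulVf // scale1r.
Qed.

Lemma log_lie_conj g A chi : g \in unitmx -> lsubst g h = chi *: h ->
  log_lie A -> log_lie (g *m A *m invmx g).
Proof. by move=> ug gh [c Ac]; exists c; apply: lder_conj gh Ac. Qed.

Lemma log_lie_conjV g A chi : g \in unitmx -> chi != 0 -> lsubst g h = chi *: h ->
  log_lie A -> log_lie (invmx g *m A *m g).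
Proof.
move=> ug chi0 gh GA; rewrite -{2}(invmxK g).
by apply: log_lie_conj (lsubst_inv ug chi0 gh) GA; rewrite unitmx_inv.
Qed.

Definition trace_rad X := log_lie X /\ forall Y, log_lie Y -> \tr (X *m Y) = 0.

Lemma trace_rad0 : trace_rad 0.
Proof.
split; first by exists 0; rewrite lder0 scale0r.
by move=> Y _; rewrite mul0mx mxtrace0.
Qed.

Lemma trace_rad_lin c X Y : trace_rad X -> trace_rad Y -> trace_rad (c *: X + Y).
Proof.
move=> [GX X0] [GY Y0]; split; first exact: log_lie_lin.
by move=> Z GZ; rewrite mulmxDl raddfD /= -scalemxAl mxtraceZ X0 // Y0 // mulr0 addr0.
Qed.

(** Invariance of the form: tr([X, Y] Z) = tr(X [Y, Z]). *)
Lemma trace_rad_bracket X Y : trace_rad X -> trace_rad Y ->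
  trace_rad (X * Y - Y * X).
Proof.
move=> [GX X0] [GY Y0]; split; first exact: log_lie_bracket.
move=> Z GZ; rewrite mulmxBl raddfB /= -!mulmxE -!mulmxA.
rewrite [\tr (Y *m (X *m Z))]mxtrace_mulC -mulmxA -raddfB -mulmxBr.
exact/X0/log_lie_bracket.
Qed.

(* Cartan's criterion: the conjugate replica Y of X lies in the Lie algebra,
   and tr (X Y) is the sum of the squared moduli of the eigenvalues of X. *)
Lemma trace_rad_nilpotent X : trace_rad X -> X ^+ n = 0.
Proof.
move=> [[c Xc] X0]; have [Y [lam [Yc trXY lam0]]] := conjugate_replica Xc.
apply: lam0; apply/rowP => i; rewrite mxE.
have /eqP : \sum_i `|lam 0 i| ^+ 2 = 0 by rewrite -trXY; apply: X0; exists c^*.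
rewrite psumr_eq0 => [|j _]; last by rewrite exprn_ge0.
by move=> /allP /(_ i (mem_index_enum _)); rewrite /= sqrf_eq0 normr_eq0 => /eqP.
Qed.

Lemma trace_rad_conj g X chi : g \in unitmx -> chi != 0 -> lsubst g h = chi *: h ->
  trace_rad X -> trace_rad (g *m X *m invmx g).
Proof.
move=> ug chi0 gh [GX X0]; split; first exact: log_lie_conj gh GX.
move=> Y GY.
have -> : \tr (g *m X *m invmx g *m Y) = \tr (X *m (invmx g *m Y *m g)).
  by rewrite -!mulmxA mxtrace_mulC !mulmxA.
exact/X0/(log_lie_conjV ug chi0 gh).
Qed.

Definition trace_rad_center Z :=
  trace_rad Z /\ forall W, trace_rad W -> comm_mx W Z.

Lemma ex_trace_rad_center X : trace_rad X -> X != 0 ->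
  exists2 Z, trace_rad_center Z & Z != 0.
Proof.
move=> radX X0; have [Z [radZ Z0 Zc]] := engel_center trace_rad0 trace_rad_lin
  trace_rad_bracket trace_rad_nilpotent radX X0.
by exists Z.
Qed.

Lemma trace_rad_center0 : trace_rad_center 0.
Proof. by split; [exact: trace_rad0 | move=> W _; rewrite /comm_mx mulmx0 mul0mx]. Qed.

Lemma trace_rad_center_lin c X Y : trace_rad_center X -> trace_rad_center Y ->
  trace_rad_center (c *: X + Y).
Proof.
move=> [rX cX] [rY cY]; split; first exact: trace_rad_lin.
move=> W rW; rewrite /comm_mx mulmxDr mulmxDl -scalemxAl -scalemxAr.
by rewrite (cX W rW) (cY W rW).
Qed.

Lemma trace_rad_center_conj g Z chi : g \in unitmx -> chi != 0 ->
  lsubst g h = chi *: h -> trace_rad_center Z -> trace_rad_center (g *m Z *m invmx g).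
Proof.
move=> ug chi0 gh [rZ cZ]; split; first exact: trace_rad_conj gh rZ.
move=> W rW.
have : trace_rad (invmx g *m W *m g).
  rewrite -{2}(invmxK g); apply: trace_rad_conj (lsubst_inv ug chi0 gh) rW.
    by rewrite unitmx_inv.
  by rewrite invr_eq0.
move=> /cZ cE.
have := congr1 (fun M => g *m M *m invmx g) cE; rewrite !mulmxA mulmxV // mul1mx.
by rewrite /comm_mx !mulmxA => ->; rewrite mulmxK.
Qed.

(** A locally nilpotent operator has only the eigenvalue 0. This is why exp X fixes h itself and not
    just its zero set. *)
Lemma trace_rad_lder X : trace_rad X -> lder X h = 0.
Proof.
move=> rX; have [[c Xc] _] := rX.
by rewrite Xc (nilpotent_eigen (trace_rad_nilpotent rX) h0 Xc) scale0r.
Qed.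

(* B stands for the linear equation tr (B Z) = 0 in Z. *)
Definition center_eqns B :=
  [\/ exists m, B = \matrix_(j, i) mcoeff m (var j * mderiv i h), log_lie B |
   exists W i j, trace_rad W /\ B = delta_mx j i *m W - W *m delta_mx j i].

Lemma tr_delta_mul i j A : \tr (delta_mx j i *m A) = A i j.
Proof.
rewrite /mxtrace (bigD1 j) //= mxE (bigD1 i) //= mxE !eqxx mul1r.
rewrite !big1 ?addr0 // => k ki; last by rewrite mxE (negbTE ki) andbF mul0r.
by rewrite mxE big1 // => l _; rewrite mxE (negbTE ki) mul0r.
Qed.

(** The three families of equations say that Z kills h, is orthogonal to the Lie algebra and
    commutes with the radical. Linear equations together with nilpotency are the form in which the
    exponential image is shown to be Zariski closed. *)
Lemma trace_rad_centerP Z : trace_rad_center Z <->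
  Z ^+ n = 0 /\ forall B, center_eqns B -> \tr (B *m Z) = 0.
Proof.
have trm m : \tr ((\matrix_(j, i) mcoeff m (var j * mderiv i h)) *m Z) =
    mcoeff m (lder Z h).
  rewrite /lder raddf_sum /mxtrace.
  under eq_bigr => j _ do rewrite mxE.
  rewrite exchange_big; apply: eq_bigr => i _ /=.
  rewrite /lin_form mulr_suml raddf_sum; apply: eq_bigr => j _ /=.
  by rewrite mxE -scalerAl mcoeffZ mulrC.
have trd W i j : \tr ((delta_mx j i *m W - W *m delta_mx j i) *m Z) =
    (W *m Z - Z *m W) i j.
  rewrite mulmxBl raddfB /= -!mulmxA [\tr (W *m _)]mxtrace_mulC -mulmxA.
  by rewrite !tr_delta_mul [RHS]mxE [X in _ = _ + X]mxE.
split=> [[rZ cZ]|[Z0 eqZ]].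
  split; first exact: trace_rad_nilpotent.
  move=> B [[m ->]|GB|[W [i [j [rW ->]]]]].
  - by rewrite trm trace_rad_lder ?mcoeff0.
  - by rewrite mxtrace_mulC; case: rZ => _; apply.
  - by rewrite trd (cZ W rW) subrr mxE.
split.
  split; last by move=> Y GY; rewrite mxtrace_mulC; apply: eqZ; apply: Or32.
  exists 0; rewrite scale0r; apply/mpolyP => m; rewrite -trm mcoeff0.
  by apply: eqZ; apply: Or31; exists m.
move=> W rW; apply/matrixP => i j; apply/eqP; rewrite -subr_eq0.
have := eqZ (delta_mx j i *m W - W *m delta_mx j i); rewrite trd => <-.
  by apply/eqP; rewrite [RHS]mxE [X in _ = _ + X]mxE.
by apply: Or33; exists W, i, j.
Qed.

(* If the trace form is nondegenerate, conjugation acts on the Lie algebra by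
   isometries, hence with determinant 1 or -1. *)
Lemma det_conj_isometry (A : 'I_n -> 'M[F]_n) g chi :
  g \in unitmx -> chi != 0 -> lsubst g h = chi *: h ->
  (forall j, log_lie (A j)) ->
  (forall X, log_lie X -> exists c : 'I_n -> F, X = \sum_j c j *: A j) ->
  (forall c : 'I_n -> F, \sum_j c j *: A j = 0 -> forall j, c j = 0) ->
  (forall X, trace_rad X -> X = 0) ->
  exists2 Q : 'M[F]_n, \det Q ^+ 2 = 1 &
    forall i, invmx g *m A i *m g = \sum_k Q i k *: A k.
Proof.
move=> ug chi0 gh GA gen free rad0.
pose B : 'M[F]_n := \matrix_(i, j) \tr (A i *m A j).
have dB : \det B != 0.
  apply/negP => /det0P[v v0 vB].
  have radX : trace_rad (\sum_i v 0 i *: A i).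
    split.
      elim/big_ind: _ => [|X Y GX GY|i _]; first by case: trace_rad0.
        by rewrite -[X]scale1r; apply: log_lie_lin.
      by rewrite -[_ *: _]addr0; apply: log_lie_lin (GA i) _; case: trace_rad0.
    move=> Y /gen[c ->]; rewrite mulmx_sumr raddf_sum big1 // => j _ /=.
    rewrite -scalemxAr mxtraceZ mulmx_suml raddf_sum /=.
    move/rowP: vB => /(_ j); rewrite !mxE => vBj.
    rewrite (eq_bigr (fun i => v 0 i * B i j)) ?vBj ?mulr0 // => i _.
    by rewrite -scalemxAl mxtraceZ mxE.
  case/eqP: v0; apply/rowP => i; rewrite mxE.
  exact: (free (v 0) (rad0 _ radX)).
have /choice[q qE] : forall i, exists c : 'I_n -> F,
    invmx g *m A i *m g = \sum_k c k *: A k.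
  by move=> i; apply: gen; apply: log_lie_conjV gh (GA i).
exists (\matrix_(i, k) q i k); last first.
  by move=> i; rewrite qE; apply: eq_bigr => k _; rewrite mxE.
set Q := \matrix_(i, k) q i k.
have BQ : B = Q *m B *m Q^T.
  apply/matrixP => i j; rewrite mxE.
  have -> : \tr (A i *m A j) = \tr ((invmx g *m A i *m g) *m (invmx g *m A j *m g)).
    by rewrite !mulmxA mulmxK // [RHS]mxtrace_mulC !mulmxA mulmxV // mul1mx.
  rewrite !qE mulmx_sumr raddf_sum /= mxE; apply: eq_bigr => l _.
  rewrite -scalemxAr mxtraceZ mulmx_suml raddf_sum /= !mxE mulrC; congr (_ * _).
  by apply: eq_bigr => k _; rewrite -scalemxAl mxtraceZ !mxE.
move: (congr1 determinant BQ); rewrite !det_mulmx det_tr => dQ.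
apply: (mulIf dB); rewrite mul1r {2}dQ; ring.
Qed.

End LieAlgebra.

(** * Exponentials of nilpotent matrices *)

Section Compositional.
Variable F : fieldType.
Implicit Types p e : {poly F}.

(** Successive approximation: e - e(0) = w X with w(0) nonzero, so a multiple of (X - e(0))^k
    corrects the coefficient of X^k. For the truncated exponential this produces the logarithm
    without writing its series. *)
Lemma comp_left_inverse e k : e^`().[0] != 0 ->
  exists l, 'X^k %| l \Po e - 'X.
Proof.
move=> e1; have [w wE] : exists w, e - (e.[0])%:P = w * 'X.
  by apply/dvdpP; rewrite -['X]subr0 -polyC0 dvdp_XsubCl rootE !hornerE subrr.
have w0 : w.[0] != 0.
  move: (congr1 (fun p => p^`().[0]) wE).
  rewrite derivB derivC subr0 derivM derivX mulr1 hornerD hornerMX mulr0 add0r.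
  by move=> <-.
elim: k => [|k [l /dvdpP[r rE]]]; first by exists 0; rewrite expr0 dvd1p.
have [k0|k_gt0] := posnP k.
  by exists 0; rewrite k0 comp_poly0 sub0r dvdpNr dvdpp.
pose c := r.[0] / w.[0] ^+ k.
exists (l - c *: ('X - (e.[0])%:P) ^+ k).
have -> : (l - c *: ('X - (e.[0])%:P) ^+ k) \Po e - 'X = (r - c *: w ^+ k) * 'X^k.
  rewrite comp_polyB comp_polyZ rmorphXn /= comp_polyB comp_polyX comp_polyC wE.
  by rewrite mulrBl -rE exprMn scalerAl addrAC.
rewrite exprS dvdp_mul ?dvdpp //.
rewrite -['X]subr0 -polyC0 dvdp_XsubCl rootE hornerD hornerN hornerZ horner_exp.
by rewrite /c divfK ?subrr // expf_neq0.
Qed.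

End Compositional.

Section Exponential.
Variables (F : numClosedFieldType) (n : nat).
Local Notation N := n.+1.
Implicit Types (Z W u : 'M[F]_N).

(* Truncated at degree n, which is exact on nilpotent matrices of size n + 1. *)
Definition exp_poly : {poly F} := \poly_(k < N) (k`!%:R)^-1.

Definition expm Z := horner_mx Z exp_poly.

Lemma expmE Z : expm Z = \sum_(k < N) (k`!%:R)^-1 *: Z ^+ k.
Proof.
rewrite /expm /exp_poly poly_def rmorph_sum; apply: eq_bigr => k _ /=.
by rewrite linearZ /= rmorphXn /= horner_mx_X.
Qed.

Lemma horner_mx_comp Z p q : horner_mx Z (p \Po q) = horner_mx (horner_mx Z q) p.
Proof.
elim/poly_ind: p => [|p c IH]; first by rewrite comp_poly0 !rmorph0.
by rewrite comp_polyD comp_polyM comp_polyX comp_polyC !rmorphD !rmorphM /= IH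
  horner_mx_X !horner_mx_C.
Qed.

Lemma horner_mx_nilpotent Z p : Z ^+ N = 0 -> 'X^N %| p -> horner_mx Z p = 0.
Proof.
by move=> Z0 /dvdpP[r ->]; rewrite rmorphM rmorphXn /= horner_mx_X Z0 mulr0.
Qed.

Lemma exp_poly_at0 : exp_poly.[0] = 1.
Proof. by rewrite horner_coef0 coef_poly /= fact0 invr1. Qed.

Lemma expm_unipotent Z : Z ^+ N = 0 -> (expm Z - 1) ^+ N = 0.
Proof.
move=> Z0.
have -> : (expm Z - 1) ^+ N = horner_mx Z ((exp_poly - 1) ^+ N).
  by rewrite rmorphXn rmorphB rmorph1.
apply: horner_mx_nilpotent => //; apply: dvdp_exp2r.
by rewrite -['X]subr0 -polyC0 dvdp_XsubCl rootE !hornerE exp_poly_at0 subrr.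
Qed.

Lemma ex_log_poly : exists l : {poly F},
  forall Z, Z ^+ N = 0 -> horner_mx (expm Z) l = Z.
Proof.
(* In size 1 the truncated exponential is the constant 1, whose derivative vanishes; but then Z =
   0. *)
case: (posnP n) => [n0|n_gt0].
  exists 0 => Z Z0; rewrite rmorph0 -Z0.
  by rewrite (congr1 (fun k => Z ^+ k.+1) n0).
have [|l lE] := @comp_left_inverse _ exp_poly N.
  by rewrite horner_coef0 coef_deriv coef_poly ltnS n_gt0 /= invr1 oner_neq0.
exists l => Z Z0; apply/eqP; rewrite -subr_eq0 -horner_mx_comp.
by rewrite -{2}(horner_mx_X Z) -rmorphB /= horner_mx_nilpotent.
Qed.

Lemma expm_trunc Z K : Z ^+ N = 0 -> (N <= K)%N ->
  expm Z = \sum_(k < K) (k`!%:R)^-1 *: Z ^+ k.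
Proof.
move=> Z0 le; rewrite expmE -(big_mkord xpredT (fun k => (k`!%:R)^-1 *: Z ^+ k)).
rewrite -(big_mkord xpredT (fun k => (k`!%:R)^-1 *: Z ^+ k)).
rewrite [RHS](@big_cat_nat _ _ _ N) //= [X in _ = _ + X]big_nat [X in _ = _ + X]big1 ?addr0 // => k.
by move=> /andP[/subnK <- _]; rewrite exprD Z0 mulr0 scaler0.
Qed.

Lemma comm_nilpotentD Z W : comm_mx Z W -> Z ^+ N = 0 -> W ^+ N = 0 ->
  (Z + W) ^+ N = 0.
Proof.
move=> cZW Z0 W0; apply: (@nilpotent_exprn _ _ _ (N + N)).
rewrite exprDn_comm //; apply: big1 => i _.
have [Ni|iN] := leqP N i; first by rewrite -(subnK Ni) exprD W0 !mulr0 mul0rn.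
have le : (N <= N + N - i)%N by rewrite -addnBA ?leq_addr // ltnW.
by rewrite -(subnK le) exprD Z0 mulr0 mul0r mul0rn.
Qed.

Lemma expmD Z W : comm_mx Z W -> Z ^+ N = 0 -> W ^+ N = 0 ->
  expm (Z + W) = expm Z * expm W.
Proof.
move=> cZW Z0 W0; have ZW0 := comm_nilpotentD cZW Z0 W0.
have leK : (N <= N + N)%N by apply: leq_addr.
rewrite (expm_trunc ZW0 leK) !expmE.
(* The Cauchy product of the two exponential sums is read off as a product of polynomials with
   matrix coefficients, evaluated at 1. *)
pose a M : {poly 'M[F]_N} := \poly_(k < N) ((k`!%:R)^-1 *: M ^+ k).
have a1 M : (a M).[1] = \sum_(k < N) (k`!%:R)^-1 *: M ^+ k.
  by rewrite horner_poly; apply: eq_bigr => k _; rewrite expr1n mulr1.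
rewrite -!a1 -hornerM_comm; last by rewrite /comm_poly mulr1 mul1r.
have sa M : (size (a M) <= N)%N by apply: size_poly.
have sab : (size (a Z * a W)%R <= N + N)%N.
  by apply: (leq_trans (size_polyMleq _ _)); rewrite (leq_trans (leq_pred _)) // leq_add.
have ak M k : M ^+ N = 0 -> (a M)`_k = (k`!%:R)^-1 *: M ^+ k.
  move=> M0; rewrite coef_poly; case: ltnP => // /subnK <-.
  by rewrite exprD M0 mulr0 scaler0.
rewrite (horner_coef_wide _ sab); apply: eq_bigr => k _.
rewrite expr1n mulr1 coefMr exprDn_comm //.
rewrite scaler_sumr; apply: eq_bigr => i _; rewrite !ak //.
rewrite -mulmxE -scalemxAl -scalemxAr mulmxE scalerA -scaler_nat scalerA.
congr (_ *: _); have ik : (i <= k)%N by rewrite -ltnS.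
have fne j : (j`!%:R : F) != 0 by rewrite pnatr_eq0 -lt0n fact_gt0.
have := bin_fact ik => /(congr1 (fun m => m%:R : F)); rewrite !natrM => bE.
apply: (mulfI (fne k)); rewrite mulrA mulfV // mul1r -bE.
by rewrite mulrC [X in X * _]mulrC; field; rewrite !fne.
Qed.

Lemma expm0 : expm 0 = 1.
Proof.
rewrite expmE big_ord_recl /= expr0 fact0 invr1 scale1r big1 ?addr0 // => i _.
by rewrite expr0n scaler0.
Qed.

Lemma expm_inv Z : Z ^+ N = 0 -> expm Z \in unitmx /\ invmx (expm Z) = expm (- Z).
Proof.
move=> Z0; have mZ0 : (- Z) ^+ N = 0 by rewrite exprNn Z0 mulr0.
have e1 : expm Z *m expm (- Z) = 1%:M.
  rewrite mulmxE -expmD ?subrr ?expm0 //.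
  by rewrite /comm_mx mulmxN mulNmx.
have [uZ _] := mulmx1_unit e1; split=> //.
by rewrite -[LHS]mulmx1 -e1 mulmxA mulVmx // mul1mx.
Qed.

Lemma expm_conj g Z : g \in unitmx -> g *m expm Z *m invmx g = expm (g *m Z *m invmx g).
Proof. by move=> ug; rewrite /expm horner_mx_uconj. Qed.

(* p(t) = h(exp(tZ) x) has derivative (lder Z h)(exp(tZ) x). *)
Lemma meval_expm (h : {mpoly F[N]}) Z (x : 'cV[F]_N) : Z ^+ N = 0 -> lder Z h = 0 ->
  meval (fun i => (expm Z *m x) i 0) h = meval (fun i => x i 0) h.
Proof.
move=> Z0 Zh.
pose c k i := (k`!%:R)^-1 * (Z ^+ k *m x) i 0.
pose y i : {poly F} := \poly_(k < N) c k i.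
pose phi : {rmorphism {mpoly F[N]} -> {poly F}} := mmap polyC y.
have phiX i : phi (var i) = y i by rewrite /phi /= mmapX mmap1U.
have phiC a : phi (mpolyC N a) = a%:P by rewrite /phi /= mmapC.
have phiE t : (phi h).[t] = meval (fun i => (y i).[t]) h.
  rewrite -[LHS]/((horner_eval t \o phi) h); move: (h); apply: eq_rmorph_mpoly => [a|i].
    by rewrite /= /horner_eval phiC hornerC mevalC.
  by rewrite /= /horner_eval phiX mevalXU.
have y0 i : (y i).[0] = x i 0.
  by rewrite horner_coef0 coef_poly /= /c fact0 invr1 mul1r expr0 mul1mx.
have y1 i : (y i).[1] = (expm Z *m x) i 0.
  rewrite horner_poly expmE mulmx_suml summxE; apply: eq_bigr => k _.
  by rewrite expr1n mulr1 -scalemxAl mxE.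
have dy i : (y i)^`() = \sum_j Z i j *: y j.
  have yk k j : (y j)`_k = c k j.
    rewrite coef_poly; case: ltnP => // /subnK <-.
    by rewrite /c exprD Z0 mulr0 mul0mx mxE mulr0.
  apply/polyP => k; rewrite coef_deriv coef_sum yk.
  under eq_bigr => j _ do rewrite coefZ yk.
  rewrite /c exprS -mulmxE -mulmxA mxE -mulrnAl mulr_sumr; apply: eq_bigr => j _.
  rewrite mulrCA; congr (_ * _); congr (_ * _).
  rewrite factS natrM invfM -[_ *+ _]mulr_natr mulrAC mulVf ?mul1r //.
  by rewrite pnatr_eq0.
have dphi : (phi h)^`() = 0.
  rewrite (@chain_rule _ _ _ phi (fun f => (phi f)^`())).
  - transitivity (phi (lder Z h)); last by rewrite Zh rmorph0.
    rewrite /lder rmorph_sum; apply: eq_bigr => i _; rewrite rmorphM [RHS]mulrC.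
    congr (_ * _); rewrite phiX dy /lin_form rmorph_sum; apply: eq_bigr => j _.
    by rewrite -mul_mpolyC rmorphM phiC phiX mul_polyC.
  - by move=> f g; rewrite rmorphD derivD.
  - by move=> a; rewrite phiC derivC.
  - by move=> f g; rewrite rmorphM derivM.
have phi_const : phi h = ((phi h)`_0)%:P.
  apply/polyP => -[|k]; rewrite coefC //=.
  have /eqP := congr1 (fun p : {poly F} => p`_k) dphi.
  by rewrite coef_deriv coef0 mulrn_eq0 /= => /eqP.
have := phiE 1; rewrite phi_const hornerC -(hornerC (phi h)`_0 0) -phi_const phiE.
by move=> /esym; rewrite (meval_eq _ y0) (meval_eq _ y1).
Qed.

(* With log given by the polynomial of ex_log_poly, the defining equations are
   u = expm (log u), (log u)^N = 0 and tr (B (log u)) = 0. *)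
Lemma zariski_closed_expm (A : 'M[F]_N -> Prop) :
  let V Z := Z ^+ N = 0 /\ forall B, A B -> \tr (B *m Z) = 0 in
  exists S : {mpoly F[(N * N)%N]} -> Prop, forall u,
    (exists2 Z, V Z & u = expm Z) <->
    u \in unitmx /\ forall p, S p -> meval (fun k => mxvec u 0 k) p = 0.
Proof.
move=> V; pose ev u : {rmorphism {mpoly F[(N * N)%N]} -> F} := meval (fun k => mxvec u 0 k).
(* The equations are all polynomials vanishing on the image; what remains is to find enough of
   them. *)
exists (fun p => forall Z, V Z -> ev (expm Z) p = 0) => u; split.
  by move=> [Z VZ ->]; split=> [|p Sp]; [have [] := expm_inv VZ.1 | apply: Sp].
move=> [uu Su]; have [l lE] := ex_log_poly.
(* The generic matrix, its logarithm and the exponential of that logarithm, whose entries supply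
   these equations. *)
pose U : 'M[{mpoly F[(N * N)%N]}]_N := \matrix_(i, j) var (mxvec_index i j).
pose LU := horner_mx U (map_poly (@mpolyC _ F) l).
pose EU := horner_mx LU (map_poly (@mpolyC _ F) exp_poly).
have evU w : map_mx (ev w) U = w.
  by apply/matrixP => i j; rewrite !mxE /ev /= mevalXU mxvecE.
have evC w (p : {poly F}) : map_poly (ev w) (map_poly (@mpolyC _ F) p) = p.
  by apply/polyP => i; rewrite !coef_map /ev /= mevalC.
have evL w : map_mx (ev w) LU = horner_mx w l by rewrite map_horner_mx evU evC.
have evE w : map_mx (ev w) EU = expm (horner_mx w l) by rewrite map_horner_mx evL evC.
have uE : u = expm (horner_mx u l).
  apply/matrixP => i j; apply/eqP; rewrite -subr_eq0.
  have := Su (U i j - EU i j); rewrite -/(ev u _) rmorphB.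
  have evUij w : ev w (U i j) = w i j by move/matrixP: (evU w) => /(_ i j); rewrite mxE.
  have evEij w : ev w (EU i j) = expm (horner_mx w l) i j by move/matrixP: (evE w) => /(_ i j); rewrite mxE.
  rewrite evUij evEij => -> // Z VZ.
  by rewrite rmorphB evUij evEij lE ?subrr //; case: VZ.
exists (horner_mx u l) => //; split.
  apply/matrixP => i j; rewrite [RHS]mxE.
  have evLN w : ev w ((LU ^+ N) i j) = (horner_mx w l ^+ N) i j.
    have -> : horner_mx w l ^+ N = map_mx (ev w) (LU ^+ N).
      by rewrite -evL; apply/esym; apply: (rmorphXn (map_mx (ev w))).
    by rewrite [RHS]mxE.
  rewrite -evLN; apply: Su => Z VZ; rewrite evLN lE; last by case: VZ.
  by case: VZ => -> _; rewrite mxE.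
move=> B AB; pose p := \tr (map_mx (@mpolyC _ F) B *m LU).
have evp w : ev w p = \tr (B *m horner_mx w l).
  rewrite /p -evL rmorph_sum; apply: eq_bigr => i _; rewrite !mxE rmorph_sum.
  by apply: eq_bigr => j _; rewrite rmorphM !mxE /ev /= mevalC.
rewrite -evp; apply: Su => Z VZ; rewrite evp lE; last by case: VZ.
by case: VZ => _; apply.
Qed.

End Exponential.

Import numFieldNormedType.Exports.
Local Open Scope classical_set_scope.

(** * Connectedness arguments *)

(** Inside A, the set K1 is closed and, as the complement of K2, also open. *)
Lemma connected_closed_cover (T : topologicalType) (A K1 K2 : set T) :
  connected A -> closed K1 -> closed K2 -> A `<=` K1 `|` K2 ->
  (forall x, A x -> K1 x -> ~ K2 x) -> (A `&` K1) !=set0 -> A `<=` K1.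
Proof.
move=> Ac c1 c2 cov disj A1.
have <- : A `&` K1 = A; last by move=> x [].
apply: Ac => //; last by exists K1.
exists (~` K2); first exact: closed_openC.
apply/seteqP; split=> x [Ax Kx]; split => //; first exact: disj.
by have [] := cov x Ax.
Qed.

Section Continuity.
Variables (F : numClosedFieldType) (T : topologicalType).
Implicit Types f g : T -> F.

Lemma continuous_cst_fun (c : F) : continuous (fun _ : T => c).
Proof. by move=> x; apply: cvg_cst. Qed.

Lemma continuousD_fun f g : continuous f -> continuous g ->
  continuous (fun x => f x + g x).
Proof. by move=> cf cg x; apply: cvgD; [exact: cf | exact: cg]. Qed.

Lemma continuousM_fun f g : continuous f -> continuous g ->
  continuous (fun x => f x * g x).
Proof. by move=> cf cg x; apply: cvgM; [exact: cf | exact: cg]. Qed.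

Lemma continuous_sum_fun I (r : seq I) (f : I -> T -> F) :
  (forall i, continuous (f i)) -> continuous (fun x => \sum_(i <- r) f i x).
Proof.
move=> cf; elim: r => [|i r IH].
  have -> : (fun x => \sum_(i <- [::]) f i x) = (fun=> 0).
    by apply: funext => x; rewrite big_nil.
  by move=> x; apply: cvg_cst.
have -> : (fun x => \sum_(j <- i :: r) f j x) =
          (fun x => f i x + \sum_(j <- r) f j x).
  by apply: funext => x; rewrite big_cons.
exact: continuousD_fun.
Qed.

Lemma continuous_prod_fun I (r : seq I) (f : I -> T -> F) :
  (forall i, continuous (f i)) -> continuous (fun x => \prod_(i <- r) f i x).
Proof.
move=> cf; elim: r => [|i r IH].
  have -> : (fun x => \prod_(i <- [::]) f i x) = (fun=> 1).
    by apply: funext => x; rewrite big_nil.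
  by move=> x; apply: cvg_cst.
have -> : (fun x => \prod_(j <- i :: r) f j x) =
          (fun x => f i x * \prod_(j <- r) f j x).
  by apply: funext => x; rewrite big_cons.
exact: continuousM_fun.
Qed.

Lemma continuous_meval n (u : T -> 'I_n -> F) (p : {mpoly F[n]}) :
  (forall i, continuous (fun x => u x i)) -> continuous (fun x => meval (u x) p).
Proof.
move=> cu; move: p; apply: mpoly_ring_ind => [c|i|p q cp cq|p q cp cq].
- have -> : (fun x => meval (u x) (mpolyC n c)) = (fun=> c).
    by apply: funext => x; rewrite mevalC.
  by move=> x; apply: cvg_cst.
- have -> : (fun x => meval (u x) (var i)) = (fun x => u x i).
    by apply: funext => x; rewrite mevalXU.
  exact: cu.
- have -> : (fun x => meval (u x) (p + q)) = (fun x => meval (u x) p + meval (u x) q).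
    by apply: funext => x; rewrite mevalD.
  exact: continuousD_fun.
- have -> : (fun x => meval (u x) (p * q)) = (fun x => meval (u x) p * meval (u x) q).
    by apply: funext => x; rewrite mevalM.
  exact: continuousM_fun.
Qed.

Lemma continuous_mx m n (u : T -> 'M[F]_(m, n)) :
  (forall i j, continuous (fun x => u x i j)) -> continuous u.
Proof.
move=> cu x; apply/cvg_ballP => e e0.
have near i : \forall y \near x, forall j, ball (u x i j) e (u y i j).
  apply: filter_forall => j.
  by have /cvg_ballP := cu i j x; apply.
have : \forall y \near x, forall i j, ball (u x i j) e (u y i j).
  exact: filter_forall.
by apply: filterS => y uy; split.
Qed.

Lemma closed_zero f : continuous f -> closed [set x | f x = 0].
Proof.
move=> cf; apply: (preimage_closed (D := [set y | y = 0])).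
  by move=> x _; apply: cf.
exact/(@accessible_closed_set1 F)/hausdorff_accessible/norm_hausdorff.
Qed.

End Continuity.

(** * Semi-invariance under connected sets of matrices *)

Section SemiInvariant.
Variables (F : numClosedFieldType) (n : nat).
Implicit Types (f : {mpoly F[n]}) (g : 'M[F]_n) (x p : 'cV[F]_n).

Definition ev f x := meval (fun i => x i 0) f.

Lemma continuous_ev_mul f x : continuous (fun g => ev f (g *m x)).
Proof.
apply: continuous_meval => i.
have -> : (fun g => (g *m x) i 0) = (fun g => \sum_j g i j * x j 0).
  by apply: funext => g; rewrite mxE.
apply: continuous_sum_fun => j; apply: continuousM_fun.
  exact: coord_continuous.
exact: continuous_cst_fun.
Qed.

Lemma continuous_det : continuous (fun g => \det g).
Proof.
apply: continuous_sum_fun => s; apply: continuousM_fun.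
  exact: continuous_cst_fun.
by apply: continuous_prod_fun => i; apply: coord_continuous.
Qed.

(** All products of at most k entries of z, with repetition. Finiteness of this list is what the
    connectedness argument needs. *)
Fixpoint products (z : seq F) k : seq F :=
  if k is k'.+1 then products z k' ++ [seq a * b | a <- z, b <- products z k']
  else [:: 1].

Lemma mem_products z k r : {subset r <= z} -> (size r <= k)%N ->
  \prod_(a <- r) a \in products z k.
Proof.
elim: k r => [|k IH] r rz.
  by rewrite leqn0 size_eq0 => /eqP->; rewrite big_nil inE.
case: r rz => [|a r] rz le; rewrite /= mem_cat.
  by rewrite IH.
apply/orP; right; rewrite big_cons; apply: allpairs_f; first by rewrite rz ?mem_head.
by apply: IH => // b br; rewrite rz // inE br orbT.
Qed.

(* On a line through p the polynomial f o g has the same roots as f and a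
   bounded degree, so f (g x) / f (g p) takes finitely many values. *)
Lemma semi_invariant f (A : set 'M[F]_n) p : connected A -> A 1%:M ->
  (forall g x, A g -> (ev f (g *m x) == 0) = (ev f x == 0)) -> ev f p != 0 ->
  forall g x, A g -> ev f (g *m x) * ev f p = ev f (g *m p) * ev f x.
Proof.
move=> Ac A1 Az p0 g0 x Ag0.
pose P g : {poly F} := line idfun (fun i => (g *m p) i 0) (fun i => (g *m (x - p)) i 0) f.
have PE g s : (P g).[s] = ev f (g *m (p + s *: (x - p))).
  rewrite horner_line; apply: meval_eq => i.
  by rewrite [in RHS]mulmxDr -scalemxAr [RHS]mxE [X in _ = _ + X]mxE mulrC.
have P0 g : (P g).[0] = ev f (g *m p) by rewrite PE scale0r addr0.
have P1 g : (P g).[1] = ev f (g *m x) by rewrite PE scale1r addrC subrK.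
have gp0 g : A g -> ev f (g *m p) != 0 by move=> Ag; rewrite Az.
have Pn0 : P 1%:M != 0.
  by apply/eqP => P10; move: (P0 1%:M) (gp0 _ A1); rewrite P10 horner0 => <-; rewrite eqxx.
have [r0 r0E] := closed_field_poly_normal (P 1%:M).
(* For a split polynomial, the ratio of its values at 1 and 0 is the product of these factors over
   its roots s. The roots of [P g] are among those of [P 1%:M], with multiplicities that may vary
   with g. *)
pose z := [seq (1 - s) / (0 - s) | s <- r0].
pose V := products z (mmeasure mdeg f).
have gV g : A g -> ev f (g *m x) / ev f (g *m p) \in V.
  move=> Ag; have [r rE] := closed_field_poly_normal (P g).
  have Pg0 : P g != 0.
    by apply/eqP => Pg0; move: (P0 g) (gp0 _ Ag); rewrite Pg0 horner0 => <-; rewrite eqxx.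
  have lc0 : lead_coef (P g) != 0 by rewrite lead_coef_eq0.
  have -> : ev f (g *m x) / ev f (g *m p) = \prod_(a <- [seq (1 - s) / (0 - s) | s <- r]) a.
    move: lc0 rE; move: (lead_coef _) => l l0 rE.
    rewrite -P0 -P1 rE !hornerZ !horner_prod big_map invfM mulrACA (mulfV l0) mul1r.
    rewrite -prodfV -big_split; apply: eq_bigr => s _.
    by rewrite !hornerXsubC.
  apply: mem_products; last first.
    rewrite size_map; apply: ltnW.
    have := size_line idfun (fun i => (g *m p) i 0) (fun i => (g *m (x - p)) i 0) f.
    by rewrite -/(P g) rE size_scale // size_prod_XsubC.
  move=> _ /mapP[s sr ->]; apply/mapP; exists s => //.
  have : root (P 1%:M) s.
    rewrite rootE PE Az // -(Az g) // -PE -rootE rE rootZ //.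
    by rewrite root_prod_XsubC.
  rewrite r0E rootZ ?lead_coef_eq0 //.
  by rewrite root_prod_XsubC.
pose K v := [set g | ev f (g *m x) - v * ev f (g *m p) = 0].
have cK v : closed (K v).
  apply: closed_zero.
  have -> : (fun g => ev f (g *m x) - v * ev f (g *m p)) =
            (fun g => ev f (g *m x) + (- v) * ev f (g *m p)).
    by apply: funext => g; rewrite mulNr.
  apply: continuousD_fun; first exact: continuous_ev_mul.
  apply: continuousM_fun; last exact: continuous_ev_mul.
  exact: continuous_cst_fun.
pose v0 := ev f x / ev f p.
(* The possible values of f(g x) / f(g p) cut A into finitely many disjoint closed parts; the
   identity lies in that of [v0]. *)
have AK : A `<=` K v0.
  apply: (@connected_closed_cover _ _ _
    (\big[setU/set0]_(v <- [seq v <- V | v != v0]) K v)) => //.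
  - by apply: closed_bigsetU => v _; apply: cK.
  - move=> g Ag; have [gv|gv] := eqVneq (ev f (g *m x) / ev f (g *m p)) v0.
      by left; rewrite /K /= -gv divfK ?subrr ?gp0.
    right; rewrite -bigcup_seq; exists (ev f (g *m x) / ev f (g *m p)).
      by rewrite /= mem_filter gv gV.
    by rewrite /K /= divfK ?subrr ?gp0.
  - move=> g Ag Kg; rewrite -bigcup_seq => -[v /=]; rewrite mem_filter => /andP[/eqP vv0 _] Kv.
    apply: vv0; apply: (mulIf (gp0 g Ag)).
    by move: Kg Kv; rewrite /K /= => /subr0_eq <- /subr0_eq.
  - exists 1%:M; split=> //; rewrite /K /= !mul1mx /v0 divfK ?subrr //.
move: (AK g0 Ag0); rewrite /K /= => /subr0_eq ->.
by rewrite mulrAC /v0 divfK // mulrC.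
Qed.

(** The two signs cut A into closed parts, disjoint because neither det g nor f(p) vanishes; the
    identity has sign plus. *)
Lemma connected_sign f (A : set 'M[F]_n) p : connected A -> A 1%:M ->
  (forall g, A g -> \det g != 0) -> ev f p != 0 ->
  (forall g, A g -> ev f (g *m p) ^+ 2 = (\det g * ev f p) ^+ 2) ->
  forall g, A g -> ev f (g *m p) = \det g * ev f p.
Proof.
move=> Ac A1 Ad p0 sq.
have cd : continuous (fun g => \det g * ev f p).
  apply: continuousM_fun; first exact: continuous_det.
  exact: continuous_cst_fun.
have sub : A `<=` [set g | ev f (g *m p) + (- 1) * (\det g * ev f p) = 0].
  apply: (@connected_closed_cover _ _ _ [set g | ev f (g *m p) + \det g * ev f p = 0]) => //.
  - apply: closed_zero; apply: continuousD_fun; first exact: continuous_ev_mul.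
    by apply: continuousM_fun => //; apply: continuous_cst_fun.
  - by apply: closed_zero; apply: continuousD_fun => //; exact: continuous_ev_mul.
  - move=> g Ag /=; have /eqP := sq g Ag; rewrite eqf_sqr => /orP[] /eqP ->.
      by left; rewrite mulN1r subrr.
    by right; rewrite addNr.
  - move=> g Ag /=; rewrite mulN1r => /subr0_eq -> /eqP.
    rewrite -mulr2n mulrn_eq0 /= mulf_eq0 (negbTE p0) orbF => /eqP d0.
    by move: (Ad g Ag); rewrite d0 eqxx.
  - by exists 1%:M; split=> //=; rewrite mul1mx det1 mul1r mulN1r subrr.
by move=> g /sub /=; rewrite mulN1r => /subr0_eq.
Qed.

End SemiInvariant.

Section Path.
Variables (R : realType) (n : nat).
Local Notation C := (Cplx R).

Lemma continuous_real_complex : continuous (fun t : R => (t%:C)%C : C).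
Proof.
move=> x; apply/cvg_ballP => e e0.
have [e1 e1E] : exists e1 : R, (e1%:C)%C = e.
  have /ger0_real := ltW e0; case: e {e0} => a b.
  by rewrite complex_real => /eqP /= ->; exists a.
have e10 : 0 < e1 by move: e0; rewrite -e1E ltcR.
apply: filterS (nbhsx_ballx x e1 e10) => y.
by rewrite /ball /= -e1E -rmorphB normc_def /= expr0n addr0 sqrtr_sqr ltcR.
Qed.

(** The image is a union of paths t -> exp(tZ), t in [0, 1], all starting at the identity. *)
Lemma connected_expm (V : 'M[C]_n.+1 -> Prop) : V 0 ->
  (forall c Z, V Z -> V (c *: Z)) ->
  connected [set u | exists2 Z, V Z & u = expm Z].
Proof.
move=> V0 VZ; pose rc (t : R) : C := (t%:C)%C.
pose path (Z : 'M[C]_n.+1) : set 'M[C]_n.+1 := (fun t : R => expm (rc t *: Z)) @` `[0, 1].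
have cpath Z : connected (path Z).
  apply: connected_continuous_connected; first exact: segment_connected.
  apply: continuous_subspaceT; apply: continuous_mx => i j.
  have -> : (fun t : R => expm (rc t *: Z) i j) =
     (fun t : R => \sum_(k <- index_enum 'I_n.+1)
        \prod_(l <- nseq k tt) rc t * ((k`!%:R)^-1 * (Z ^+ k) i j)).
    apply: funext => t; rewrite expmE summxE; apply: eq_bigr => k _.
    by rewrite exprZn !mxE big_nseq iter_mulr_1 mulrCA.
  apply: continuous_sum_fun => k; apply: continuousM_fun.
    by apply: continuous_prod_fun => _; apply: continuous_real_complex.
  exact: continuous_cst_fun.
have -> : [set u | exists2 Z, V Z & u = expm Z] = \bigcup_(Z in [set Z | V Z]) path Z.
  apply/seteqP; split=> u.
    move=> [Z VZZ ->]; exists Z => //; exists 1; last by rewrite scale1r.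
    by rewrite /= in_itv /= ler01 lexx.
  by move=> [Z VZZ [t _ <-]]; exists (rc t *: Z) => //; apply: VZ.
apply: bigcup_connected => // ; exists 1 => Z VZZ; exists 0.
  by rewrite /= in_itv /= ler01 lexx.
by rewrite scale0r expm0.
Qed.

End Path.

(** * The identity component *)

Section Group.
Variables (R : realType) (n : nat).
Local Notation C := (Cplx R).
Implicit Types (h : {mpoly C[n]}) (g : 'M[C]_n).

Lemma stabilizer1 h : stabilizer h 1%:M.
Proof.
split; first exact: unitmx1.
apply/seteqP; split=> x; first by move=> [y hy <-]; rewrite mul1mx.
by exists x => //; rewrite mul1mx.
Qed.

Lemma stabilizer_eval0 h g x : stabilizer h g ->
  (ev h (g *m x) == 0) = (ev h x == 0).
Proof.
move=> [ug gZ]; apply/eqP/eqP => [gx0|x0].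
  have : zero_locus h (g *m x) by [].
  rewrite -gZ => -[y hy /(congr1 (mulmx (invmx g)))].
  by rewrite !mulmxA mulVmx // !mul1mx => <-.
suff : zero_locus h (g *m x) by [].
by rewrite -gZ; exists x.
Qed.

Lemma eval_invariant_stabilizer h g : g \in unitmx ->
  (forall x, ev h (g *m x) = ev h x) -> stabilizer h g.
Proof.
move=> ug gh; split=> //; apply/seteqP; split=> x.
  by move=> [y hy <-]; apply: etrans (gh y) hy.
move=> hx; exists (invmx g *m x); last by rewrite mulmxA mulmxV // mul1mx.
by apply: etrans (esym (gh _)) _; rewrite mulmxA mulmxV // mul1mx.
Qed.

Lemma G0_refl h : G0 h 1%:M.
Proof. exact/connected_component_refl/stabilizer1. Qed.

Lemma G0_unit h g : G0 h g -> g \in unitmx.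
Proof. by move=> /connected_component_sub[]. Qed.

Lemma G0_semi_invariant h p g : ev h p != 0 -> G0 h g ->
  forall x, ev h (g *m x) * ev h p = ev h (g *m p) * ev h x.
Proof.
move=> p0 Gg x; apply: (semi_invariant (A := G0 h)) => //.
- exact: component_connected.
- exact: G0_refl.
- by move=> g' y /connected_component_sub /stabilizer_eval0.
Qed.

Lemma G0_lsubst h p g : ev h p != 0 -> G0 h g ->
  exists2 chi, chi != 0 & lsubst g h = chi *: h.
Proof.
move=> p0 Gg; exists (ev h (g *m p) / ev h p).
  rewrite mulf_neq0 ?invr_eq0 // stabilizer_eval0 //.
  exact: connected_component_sub Gg.
apply: mpoly_eq_meval => x; pose y : 'cV[C]_n := \col_i x i.
have xy f : meval x f = ev f y by apply: meval_eq => i; rewrite mxE.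
rewrite mevalZ !xy /ev meval_lsubst -/(ev h _).
by apply: (mulIf p0); rewrite (G0_semi_invariant p0 Gg) mulrAC divfK.
Qed.

End Group.

(** * The unipotent group obtained from the centre of the trace radical *)

Section Reductive.
Variables (R : realType) (n : nat).
Local Notation C := (Cplx R).
Local Notation N := n.+1.
Variables (h : {mpoly C[N]}) (p : 'cV[C]_N).
Hypotheses (h0 : h != 0) (p0 : ev h p != 0).

Lemma exp_center_subgroup :
  subgroup_GL [set u | exists2 Z, trace_rad_center h Z & u = expm Z].
Proof.
have nilp Z : trace_rad_center h Z -> Z ^+ N = 0.
  by case=> /trace_rad_nilpotent.
split.
- by move=> _ [Z cZ ->]; have [] := expm_inv (nilp Z cZ).
- by exists 0; [exact: trace_rad_center0 | rewrite expm0].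
- move=> _ _ [Z cZ ->] [W cW ->]; exists (Z + W).
    by rewrite -[Z]scale1r; apply: trace_rad_center_lin.
  rewrite expmD //; [|exact: nilp|exact: nilp].
  by apply: cW.2; case: cZ.
- move=> _ [Z cZ ->]; have [_ ->] := expm_inv (nilp Z cZ); exists (- Z) => //.
  rewrite -scaleN1r -[_ *: _]addr0; apply: trace_rad_center_lin => //.
  exact: trace_rad_center0.
Qed.

Lemma exp_center_closed :
  zariski_closed_GL [set u | exists2 Z, trace_rad_center h Z & u = expm Z].
Proof.
have [S SP] := zariski_closed_expm (center_eqns h); exists [set q | S q].
apply/seteqP; split=> u.
  by move=> [Z /(trace_rad_centerP h0) VZ uE]; apply/SP; exists Z.
by move=> /SP[Z VZ uE]; exists Z => //; apply/(trace_rad_centerP h0).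
Qed.

Lemma exp_center_connected :
  connected [set u | exists2 Z, trace_rad_center h Z & u = expm Z].
Proof.
apply: connected_expm; first exact: trace_rad_center0.
move=> c Z cZ; rewrite -[_ *: _]addr0; apply: trace_rad_center_lin => //.
exact: trace_rad_center0.
Qed.

(** The group lies in G0 because it fixes h, contains 1 and is connected. An element of G0 rescales
    h, so conjugation by it preserves the radical and hence its centre. *)
Lemma exp_center_normal :
  normal_in [set u | exists2 Z, trace_rad_center h Z & u = expm Z] (G0 h).
Proof.
split.
  apply: connected_component_max; last exact: exp_center_connected.
    by exists 0; [exact: trace_rad_center0 | rewrite expm0].
  move=> _ [Z cZ ->]; have Z0 : Z ^+ N = 0 by case: cZ => /trace_rad_nilpotent.
  apply: eval_invariant_stabilizer; first by have [] := expm_inv Z0.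
  by move=> x; apply: meval_expm => //; apply: trace_rad_lder => //; case: cZ.
move=> g _ Gg [Z cZ ->]; have ug := G0_unit Gg.
have [chi chi0 gh] := G0_lsubst p0 Gg.
exists (g *m Z *m invmx g); first exact: trace_rad_center_conj gh cZ.
exact: expm_conj.
Qed.

Lemma reductive_trace_rad0 : reductive (G0 h) -> forall X, trace_rad h X -> X = 0.
Proof.
move=> red X rX; apply: contrapT => /eqP X0.
have [Z cZ Z0] := ex_trace_rad_center rX X0.
have nZ : Z ^+ N = 0 by case: cZ => /trace_rad_nilpotent.
have N1 : [set u | exists2 Z, trace_rad_center h Z & u = expm Z] = [set 1%:M].
  apply: red exp_center_subgroup exp_center_closed exp_center_connected exp_center_normal _.
  move=> _ [W cW ->]; exists N; apply: expm_unipotent.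
  by case: cW => /trace_rad_nilpotent.
have eZ : expm Z = 1%:M.
  have : [set u | exists2 Z, trace_rad_center h Z & u = expm Z] (expm Z) by exists Z.
  by rewrite N1.
case/eqP: Z0; have [l lE] := ex_log_poly C n.
rewrite -(lE Z nZ) eZ -[1%:M]/(1 : 'M_N) -expm0 lE //.
by rewrite expr0n.
Qed.

End Reductive.

Theorem corollary2p9 (R : realType) (n : nat) (h : {mpoly (Cplx R)[n]}) :
  linear_free_divisor h -> reductive (G0 h) -> special h.
Proof.
(* In dimension 0 every polynomial is constant, which [reduced_hypersurface] excludes. *)
case: n h => [|n] h.
  by move=> [[+ _] _]; rewrite (nvar0_mpolyC h) mmeasureC; case: eqP.
move=> [[hsize hrad] [m [b [[bder bgen bfree] blin]]]] red.
have h0 : h != 0 by apply: contraTneq hsize => ->; rewrite mmeasure0.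
have [x0 x0h] := mpoly_nonroot h0; pose p : 'cV_n.+1 := \col_i x0 i.
have p0 : ev h p != 0.
  by rewrite /ev (meval_eq (v2 := x0)) // => i; rewrite mxE.
have rad2 : radical_gen h by move=> f; apply: (hrad f 2).
pose B := \matrix_(j < m) b j.
have bB : basis_der h B.
  split.
  - by move=> j; rewrite rowK; apply: bder.
  - move=> X /bgen[c ->]; exists (\row_j c j); rewrite mulmx_sum_row.
    by apply: eq_bigr => j _; rewrite rowK mxE.
  - move=> c cB; apply/rowP => j; rewrite mxE; apply: (bfree (c 0)).
    by rewrite -[RHS]cB mulmx_sum_row; apply: eq_bigr => i _; rewrite rowK.
have mN : m = n.+1 by apply: basis_der_card bB.
subst m.
have [c c0 cE] := saito h0 rad2 hsize bB.
pose A j : 'M_n.+1 := \matrix_(i, k) mcoeff (mnm1 k) (b j 0 i).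
have bA j : b j = \row_i lin_form (A j) i by apply/homog1_lin_form/blin.
have vA X : vder (\row_i lin_form X i) h = lder X h.
  by apply: eq_bigr => i _; rewrite mxE.
have GA j : log_lie h (A j).
  have [g gE] := bder j; apply: (lder_in_ideal h0 (g := g)).
  by rewrite -vA -bA.
have gen X : log_lie h X -> exists a : 'I_n.+1 -> Cplx R, X = \sum_j a j *: A j.
  move=> [a Xa].
  have [|q qE] := bgen (\row_i lin_form X i).
    by exists (mpolyC _ a); rewrite mul_mpolyC -Xa -vA.
  (* The polynomial multipliers are replaced by their constant terms: the fields being linear,
     nothing else contributes in degree 1. *)
  exists (fun j => mcoeff mnm0 (q j)); apply/matrixP => i k.
  rewrite -mcoeffU_lin_form summxE.
  move/rowP: qE => /(_ i); rewrite mxE => ->; rewrite summxE raddf_sum.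
  apply: eq_bigr => j _ /=.
  by rewrite bA !mxE mcoeffU_mul_lin_form mxE.
have free (a : 'I_n.+1 -> Cplx R) : \sum_j a j *: A j = 0 -> forall j, a j = 0.
  move=> aA j; suff : mpolyC n.+1 (a j) = 0.
    by move=> /eqP; rewrite mpolyC_eq0 => /eqP.
  apply: (bfree (fun j => mpolyC _ (a j))); apply/rowP => i.
  rewrite summxE mxE.
  transitivity (lin_form (\sum_j a j *: A j) i); last first.
    by rewrite aA /lin_form big1 // => k _; rewrite mxE scale0r.
  rewrite (big_morph (fun X => lin_form X i) (id1 := 0) (op1 := +%R)).
  - by apply: eq_bigr => k _; rewrite lin_formZ bA !mxE mul_mpolyC.
  - by move=> X Y; rewrite lin_formD.
  - by rewrite /lin_form big1 // => k _; rewrite mxE scale0r.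
have rad0 := reductive_trace_rad0 h0 p0 red.
pose M (x : 'cV[Cplx R]_n.+1) : 'M[Cplx R]_n.+1 := \matrix_j (A j *m x)^T.
have detM x : \det (M x) = c * ev h x.
  rewrite /ev -mevalZ -cE -det_map_mx; congr (\det _).
  apply/matrixP => j i; rewrite !mxE bA mxE raddf_sum; apply: eq_bigr => k _ /=.
  by rewrite mevalZ mevalXU.
(* With Q the matrix of X -> g^-1 X g in the basis A_j, M(g p) = Q M(p) g^T gives h(g p) = det Q *
   det g * h(p). Only the square of det Q is known to be 1, hence the squares. *)
have sq g : G0 h g -> ev h (g *m p) ^+ 2 = (\det g * ev h p) ^+ 2.
  move=> Gg; have ug := G0_unit Gg; have [chi chi0 gh] := G0_lsubst p0 Gg.
  have [Q dQ QE] := det_conj_isometry ug chi0 gh GA gen free rad0.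
  have MQ : M (g *m p) = Q *m M p *m g^T.
    apply/row_matrixP => i; rewrite rowK row_mul.
    have -> : A i *m (g *m p) = g *m ((invmx g *m A i *m g) *m p).
      by rewrite !mulmxA mulmxV // mul1mx.
    rewrite trmx_mul; congr (_ *m _); rewrite QE row_mul mulmx_suml raddf_sum.
    rewrite mulmx_sum_row; apply: eq_bigr => k _.
    by rewrite rowK [row i Q 0 k]mxE -scalemxAl; apply: linearZ.
  have := detM (g *m p); rewrite MQ !det_mulmx det_tr detM => hE.
  apply: (mulfI (expf_neq0 2 c0)); rewrite -exprMn -hE.
  rewrite !exprMn dQ; ring.
have det_chi g : G0 h g -> forall x, ev h (g *m x) = \det g * ev h x.
  move=> Gg x; apply: (mulIf p0); rewrite (G0_semi_invariant p0 Gg).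
  rewrite (@connected_sign _ _ h (G0 h) p) //.
  - by rewrite mulrAC.
  - exact: component_connected.
  - exact: G0_refl.
  - by move=> g' /G0_unit; rewrite unitmxE unitfE.
exists (fun g => \det g) => //; split => //.
- by move=> g /G0_unit; rewrite unitmxE unitfE.
- by move=> g1 g2 _ _; rewrite det_mulmx.
Qed.
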